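(* Let $K$ be a field, $k\ge 0$ an integer, $G=\mathcal{G}_{lr}$ and $A=[a_{ij}]\in M_{m,n}^{(k)}$. The algorithm OrbitEq described in the context terminates and is correct: its output consists of finitely many polynomials $F_1,\ldots,F_r\in K[u_1,\ldots,u_t]$, $t=\dim M_{m,n}^{(k)}=mn\binom{s+k}{k}$, such that the variety $V(F_1,\ldots,F_r)\subset M_{m,n}^{(k)}$ coincides with the (Zariski) closure of the orbit $\mathcal{G}_{lr}^{(k)}A$.
   Context: $K$ is a field of arbitrary characteristic, $R=K[[x_1,\ldots,x_s]]$, $\mathfrak{m}=\langle x_1,\ldots,x_s\rangle$, $M_{m,n}=Mat(m,n,R)$, and $M_{m,n}^{(k)}=M_{m,n}/\mathfrak{m}^{k+1}M_{m,n}$, identified with $m\times n$ matrices of polynomials of degree at most $k$ in ${\bf x}=(x_1,\ldots,x_s)$. It is an affine space of dimension $t=mn\binom{s+k}{k}$ with coordinate ring $K[u]=K[u_1,\ldots,u_t]$, the $u_i$ being the coordinates given by the coefficients of the monomials ${\bf x}^a$, $|a|\le k$, in the matrix entries. For a polynomial or power series, $jet_k$ denotes truncation after terms of degree $k$ in ${\bf x}$. $\mathcal{G}_{lr}=(GL(m,R)\times GL(n,R))\rtimes Aut(R)$ acts on $M_{m,n}$ by $(U,V,\phi)\cdot A=U\,\phi(A)\,V$, $\phi(A)=[a_{ij}(\phi(x_1),\ldots,\phi(x_s))]$. $\mathcal{G}_{lr}^{(k)}$ is the affine algebraic group of $k$-jets of elements of $\mathcal{G}_{lr}$, acting on $M_{m,n}^{(k)}$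 by letting representatives act and taking $k$-jets. Varieties are considered as sets with the Zariski topology over the algebraic closure $\bar K$, defined over $K$. Algorithm OrbitEq. Input: $k$ and $A=[a_{ij}]\in M_{m,n}^{(k)}$. Step 1. Introduce new variables $U_{ija}$ ($1\le i,j\le m$, $0\le|a|\le k$), $V_{ija}$ ($1\le i,j\le n$, $0\le|a|\le k$), $G_{ij}$ ($1\le i,j\le s$), $H_{ia}$ ($1\le i\le s$, $2\le|a|\le k$), where $a=(a_1,\ldots,a_s)$ are multi-indices; write $U,V,G$ for these collections of variables ($G$ comprising the $G_{ij}$ and $H_{ia}$). In $K[{\bf x},U,V,G]$ define, with $\delta_{ij}$ the Kronecker symbol, $G_i=\sum_{j=1}^s(\delta_{ij}+G_{ij})x_j+\sum_{|a|=2}^kH_{ia}{\bf x}^a$ ($i=1,\ldots,s$), $U_{ij}=\delta_{ij}+U_{ij0}+\sum_{|a|=1}^kU_{ija}{\bf x}^a$ ($i,j=1,\ldots,m$), $V_{ij}=\delta_{ij}+V_{ij0}+\sum_{|a|=1}^kV_{ija}{\bf x}^a$ ($i,j=1,\ldots,n$). (Thus $\mathcal{G}_{lr}^{(k)}$ is the complement of $\det(1+[G_{ij}])\det(1+[U_{ij0}])\det(1+[V_{ij0}])=0$ in the affine space with coordinates $U,V,G$.) Step 2. Form the matrix $B=[b_{ij}]=jet_k\left([U_{ij}]\cdot[a_{ij}(G_1,\ldots,G_s)]\cdot[V_{ij}]\right)\in Mat(m,n,K[{\bf x},U,V,G])$, the $k$-jet being taken with respect to ${\bf x}$. Step 3.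 Write $b_{ij}=\sum_{|a|=0}^kc_{ija}{\bf x}^a$ with $c_{ija}\in K[U,V,G]$, and denote the $t$ polynomials $c_{ija}$ by $c_1,\ldots,c_t$, ordered compatibly with the coordinates $u_1,\ldots,u_t$. Step 4. Let $D\subset K[U,V,G,u]$ be the ideal generated by $u_i-c_i(U,V,G)$, $i=1,\ldots,t$. Eliminate the variables $U,V,G$ from $D$ by computing a standard basis with respect to an elimination ordering, obtaining finitely many polynomials $F_1,\ldots,F_r\in K[u]$ generating $D\cap K[u]$. Step 5. Return $F_1,\ldots,F_r$. *)

(* Defs.v *)
From HB Require Import structures.
From mathcomp Require Import all_boot all_order all_algebra.
From mathcomp Require Import mpoly.
From mathcomp Require Import boolp.

Set Implicit Arguments.
Unset Strict Implicit.
Unset Printing Implicit Defensive.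

Import Order.TTheory GRing.Theory.

Local Open Scope ring_scope.

Record mpseries (s : nat) (R : Type) := MPSeries { pscoef : 'X_{1..s} -> R }.

(* Equality of power series is decided classically. *)
HB.instance Definition _ s R := gen_eqMixin (mpseries s R).
HB.instance Definition _ s R := gen_choiceMixin (mpseries s R).

Section PowerSeries.
Variables (s : nat) (R : comNzRingType).
Implicit Types f g h : mpseries s R.

Lemma psP f g : pscoef f =1 pscoef g -> f = g.
Proof. by case: f g => [f] [g] /= /funext ->. Qed.

Definition ps_zero : mpseries s R := MPSeries (fun=> 0).
Definition ps_opp f := MPSeries (fun a => - pscoef f a).
Definition ps_add f g := MPSeries (fun a => pscoef f a + pscoef g a).
Definition ps_scale (c : R) f := MPSeries (fun a => c * pscoef f a).
Definition ps_one : mpseries s R := MPSeries (fun a => (a == 0%MM)%:R).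
Definition ps_mul f g : mpseries s R :=
  MPSeries (fun a => \sum_(bc : 'X_{1..s < (mdeg a).+1, (mdeg a).+1}
                            | a == (bc.1 + bc.2)%MM)
                       pscoef f bc.1 * pscoef g bc.2).

Lemma ps_addA : associative ps_add.
Proof. by move=> f g h; apply/psP=> a /=; rewrite addrA. Qed.
Lemma ps_addC : commutative ps_add.
Proof. by move=> f g; apply/psP=> a /=; rewrite addrC. Qed.
Lemma ps_add0 : left_id ps_zero ps_add.
Proof. by move=> f; apply/psP=> a /=; rewrite add0r. Qed.
Lemma ps_addN : left_inverse ps_zero ps_opp ps_add.
Proof. by move=> f; apply/psP=> a /=; rewrite addNr. Qed.

HB.instance Definition _ :=
  GRing.isZmodule.Build (mpseries s R) ps_addA ps_addC ps_add0 ps_addN.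

Definition ps_jet (k : nat) f : {mpoly R[s]} :=
  \sum_(a : 'X_{1..s < k.+1}) pscoef f a *: 'X_[a].

Lemma mcoeff_ps_jet k f a :
  (ps_jet k f)@_a = if (mdeg a < k.+1)%N then pscoef f a else 0.
Proof.
rewrite /ps_jet raddf_sum /=; case: ifP => [lt_ak|ge_ak].
  rewrite (bigD1 (BMultinom lt_ak)) //= mcoeffZ mcoeffX eqxx mulr1.
  rewrite big1 ?addr0 // => b neq_b; rewrite mcoeffZ mcoeffX.
  have /negbTE -> : bmnm b != a by apply: contraNneq neq_b => eq_b; apply/eqP/val_inj.
  by rewrite mulr0.
rewrite big1 // => b _; rewrite mcoeffZ mcoeffX.
have /negbTE -> : bmnm b != a by apply: contraFneq ge_ak => <-; apply: bmdeg.
by rewrite mulr0.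
Qed.

Lemma pscoefM k f g a : (mdeg a < k.+1)%N ->
  pscoef (ps_mul f g) a = (ps_jet k f * ps_jet k g)@_a.
Proof.
move=> lt_ak; rewrite mcoeffM /=; apply: eq_bigr => -[b c] /= _.
have: (mdeg b <= mdeg a)%N by have := bmdeg b; rewrite ltnS.
have: (mdeg c <= mdeg a)%N by have := bmdeg c; rewrite ltnS.
move=> le_c le_b; rewrite !mcoeff_ps_jet.
by rewrite (leq_ltn_trans le_c lt_ak) (leq_ltn_trans le_b lt_ak).
Qed.

Lemma mcoeffM_jet k (p q p' q' : {mpoly R[s]}) a : (mdeg a < k.+1)%N ->
    (forall b, (mdeg b < k.+1)%N -> p@_b = p'@_b) ->
    (forall b, (mdeg b < k.+1)%N -> q@_b = q'@_b) ->
  (p * q)@_a = (p' * q')@_a.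
Proof.
move=> lt_ak eq_p eq_q; rewrite !mcoeffM; apply: eq_bigr => -[b c] /= _.
have: (mdeg b <= mdeg a)%N by have := bmdeg b; rewrite ltnS.
have: (mdeg c <= mdeg a)%N by have := bmdeg c; rewrite ltnS.
move=> le_c le_b.
by rewrite eq_p ?(leq_ltn_trans le_b lt_ak) // eq_q ?(leq_ltn_trans le_c lt_ak).
Qed.

Lemma mcoeff_ps_jetM k f g a : (mdeg a < k.+1)%N ->
  (ps_jet k (ps_mul f g))@_a = (ps_jet k f * ps_jet k g)@_a.
Proof. by move=> lt_ak; rewrite mcoeff_ps_jet lt_ak; apply: pscoefM. Qed.

Lemma ps_mulA : associative ps_mul.
Proof.
move=> f g h; apply/psP=> a; have lt_a := ltnSn (mdeg a).
rewrite !(pscoefM _ _ lt_a).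
transitivity (ps_jet (mdeg a) f * (ps_jet (mdeg a) g * ps_jet (mdeg a) h))@_a.
  by apply: (mcoeffM_jet lt_a) => // b lt_b; apply: mcoeff_ps_jetM.
rewrite mulrA; apply: (mcoeffM_jet lt_a) => // b lt_b.
by apply/esym/mcoeff_ps_jetM.
Qed.

Lemma ps_mulC : commutative ps_mul.
Proof.
move=> f g; apply/psP=> a; have lt_a := ltnSn (mdeg a).
by rewrite !(pscoefM _ _ lt_a) mulrC.
Qed.

Lemma ps_mul1 : left_id ps_one ps_mul.
Proof.
move=> f; apply/psP=> a; have lt_a := ltnSn (mdeg a).
rewrite (pscoefM _ _ lt_a).
rewrite (mcoeffM_jet (p' := 1) (q' := ps_jet (mdeg a) f) lt_a) //.
  by rewrite mul1r mcoeff_ps_jet lt_a.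
by move=> b lt_b; rewrite mcoeff_ps_jet lt_b mcoeff1.
Qed.

Lemma ps_mulDl : left_distributive ps_mul ps_add.
Proof.
move=> f g h; apply/psP=> a; have lt_a := ltnSn (mdeg a).
transitivity ((ps_jet (mdeg a) f + ps_jet (mdeg a) g) * ps_jet (mdeg a) h)@_a.
  rewrite (pscoefM _ _ lt_a); apply: (mcoeffM_jet lt_a) => // b lt_b.
  by rewrite mcoeffD !mcoeff_ps_jet lt_b.
by rewrite mulrDl mcoeffD -!(pscoefM _ _ lt_a).
Qed.

Lemma ps_oner_neq0 : ps_one != ps_zero.
Proof.
apply/eqP=> /(congr1 (fun f => pscoef f 0%MM)) /= /eqP.
by rewrite eqxx oner_eq0.
Qed.

HB.instance Definition _ :=
  GRing.Zmodule_isComNzRing.Build (mpseries s R)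
    ps_mulA ps_mulC ps_mul1 ps_mulDl ps_oner_neq0.

Lemma ps_scaleA c d f : ps_scale c (ps_scale d f) = ps_scale (c * d) f.
Proof. by apply/psP=> a /=; rewrite mulrA. Qed.
Lemma ps_scale1 : left_id 1 ps_scale.
Proof. by move=> f; apply/psP=> a /=; rewrite mul1r. Qed.
Lemma ps_scaleDr : right_distributive ps_scale +%R.
Proof. by move=> c f g; apply/psP=> a /=; rewrite mulrDr. Qed.
Lemma ps_scaleDl f : {morph ps_scale^~ f : c d / c + d}.
Proof. by move=> c d; apply/psP=> a /=; rewrite mulrDl. Qed.

HB.instance Definition _ :=
  GRing.Zmodule_isLmodule.Build R (mpseries s R)
    ps_scaleA ps_scale1 ps_scaleDr ps_scaleDl.

Lemma ps_scaleAl (c : R) f g : c *: (f * g) = (c *: f) * g.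
Proof.
apply/psP=> a; rewrite /= big_distrr /=.
by apply: eq_bigr => bc _; rewrite mulrA.
Qed.

HB.instance Definition _ :=
  GRing.Lmodule_isLalgebra.Build R (mpseries s R) ps_scaleAl.

Definition ps_unit : pred (mpseries s R) := fun f => `[< exists g, g * f = 1 >].
Definition ps_inv f : mpseries s R :=
  if pselect (exists g, g * f = 1) is left ex then projT1 (cid ex) else f.

Lemma ps_mulVr : {in ps_unit, left_inverse 1 ps_inv *%R}.
Proof.
move=> f /asboolP f_unit; rewrite /ps_inv.
by case: pselect => // ex; case: cid.
Qed.
Lemma ps_unitP f g : g * f = 1 -> ps_unit f.
Proof. by move=> gf; apply/asboolP; exists g. Qed.
Lemma ps_inv_out : {in [predC ps_unit], ps_inv =1 id}.
Proof.
move=> f /asboolP f_nunit; rewrite /ps_inv.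
by case: pselect.
Qed.

HB.instance Definition _ :=
  GRing.ComNzRing_hasMulInverse.Build (mpseries s R) ps_mulVr ps_unitP ps_inv_out.

Definition ps_of_mpoly (p : {mpoly R[s]}) : mpseries s R :=
  MPSeries (fun a => p@_a).

End PowerSeries.

Definition mpoly_jet (R : nzRingType) (s k : nat) (p : {mpoly R[s]}) : {mpoly R[s]} :=
  \sum_(a : 'X_{1..s < k.+1}) p@_a *: 'X_[a].

(* Membership in M_{m,n}^{(k)}; msize is the degree plus one. *)
Definition is_jet (R : nzRingType) (m n s k : nat) (B : 'M[{mpoly R[s]}]_(m, n)) : Prop :=
  forall i j, (msize (B i j) <= k.+1)%N.

(* The coordinates u_1, ..., u_t are indexed by an entry (i, j) and a monomial
   x^a with |a| <= k, in the order of the enumeration of this finite type. *)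
Definition uindex (m n s k : nat) : finType :=
  ('I_m * 'I_n * 'X_{1..s < k.+1})%type.

Definition ncoord (m n s k : nat) : nat := #|{: uindex m n s k}|.

Definition ucoord (R : nzRingType) (m n s k : nat) (B : 'M[{mpoly R[s]}]_(m, n))
    (l : 'I_(ncoord m n s k)) : R :=
  let: (i, j, a) := enum_val l in (B i j)@_(bmnm a).

(* Elements of (GL(m,R) x GL(n,R)) x| Aut(R) for R = F[[x_1, ..., x_s]], where
   Aut(R) is the group of F-algebra automorphisms of R. *)
Record glr (F : fieldType) (m n s : nat) := Glr {
  glrU : 'M[mpseries s F]_m;
  glrV : 'M[mpseries s F]_n;
  glrPhi : {lrmorphism mpseries s F -> mpseries s F};
  glrU_unit : glrU \in unitmx;
  glrV_unit : glrV \in unitmx;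
  glrPhi_bij : bijective glrPhi
}.

(* For an automorphism phi and a power series a, the series
   a(phi(x_1), ..., phi(x_s)) is phi(a). *)
Definition glr_act (F : fieldType) (m n s : nat) (g : glr F m n s)
    (A : 'M[mpseries s F]_(m, n)) : 'M[mpseries s F]_(m, n) :=
  glrU g *m map_mx (glrPhi g) A *m glrV g.

(* The action of the k-jet of g on A is by definition the k-jet of g . A. *)
Definition jet_orbit (F : fieldType) (m n s k : nat) (A B : 'M[{mpoly F[s]}]_(m, n)) : Prop :=
  exists g : glr F m n s,
    B = map_mx (ps_jet k) (glr_act g (map_mx (@ps_of_mpoly s F) A)).

Definition zariski_closed (F : fieldType) (m n s k : nat)
    (Z : 'M[{mpoly F[s]}]_(m, n) -> Prop) : Prop :=
  exists E : {mpoly F[ncoord m n s k]} -> Prop,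
    forall B, Z B <-> is_jet k B /\ forall f, E f -> f.@[ucoord B] = 0.

Definition zariski_closure (F : fieldType) (m n s k : nat)
    (X : 'M[{mpoly F[s]}]_(m, n) -> Prop) (B : 'M[{mpoly F[s]}]_(m, n)) : Prop :=
  forall Z, zariski_closed k Z -> (forall C, X C -> Z C) -> Z B.

Definition variety (K L : fieldType) (iota : {rmorphism K -> L}) (m n s k : nat)
    (F : seq {mpoly K[ncoord m n s k]}) (B : 'M[{mpoly L[s]}]_(m, n)) : Prop :=
  is_jet k B /\ forall f, f \in F -> (map_mpoly iota f).@[ucoord B] = 0.

Definition in_ideal (R : comNzRingType) (E : seq R) (f : R) : Prop :=
  exists c : 'I_(size E) -> R, f = \sum_(i < size E) c i * E`_i.

Definition free_of_first (p t : nat) (a : 'X_{1..p + t}) : bool :=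
  [forall i : 'I_p, a (lshift t i) == 0%N].

(* A (global) monomial ordering le, with the elimination property for the
   first p variables: a polynomial whose leading monomial does not involve
   them does not involve them at all. *)
Record elim_order (p t : nat) (le : rel 'X_{1..p + t}) : Prop := ElimOrder {
  elim_order_total : total le;
  elim_order_anti : antisymmetric le;
  elim_order_trans : transitive le;
  elim_order_add : forall a b c, le a b -> le (a + c)%MM (b + c)%MM;
  elim_order_ge0 : forall a, le 0%MM a;
  elim_order_elim : forall a b, le a b -> free_of_first b -> free_of_first a
}.

Section StandardBases.
Variables (K : fieldType) (N : nat) (le : rel 'X_{1..N}).
Implicit Types (f g h : {mpoly K[N]}) (E S : seq {mpoly K[N]}).

(* Leading monomial, with value 0 at the zero polynomial. *)
Definition lmon f : 'X_{1..N} :=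
  foldr (fun a b => if le b a then a else b) 0%MM (msupp f).

Definition lcof f : K := f@_(lmon f).

Definition standard_basis E S : Prop :=
  (forall g, g \in S -> in_ideal E g) /\
  (forall f, in_ideal E f -> f != 0 ->
     exists g, [/\ g \in S, g != 0 & (lmon g <= lmon f)%MM]).

Definition spoly f g : {mpoly K[N]} :=
  let l := mlcm (lmon f) (lmon g) in
  (lcof g *: 'X_[(l - lmon f)%MM]) * f - (lcof f *: 'X_[(l - lmon g)%MM]) * g.

Definition reduce h g : {mpoly K[N]} :=
  h - ((lcof h / lcof g) *: 'X_[(lmon h - lmon g)%MM]) * g.

(* In the two loops below fuel bounds the number of steps and the value None
   means that the computation did not finish within that bound. *)

Fixpoint normal_form (fuel : nat) S h : option {mpoly K[N]} :=
  if fuel is fuel'.+1 then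
    if h == 0 then Some h
    else if [seq g <- S | (g != 0) && (lmon g <= lmon h)%MM] is g :: _
    then normal_form fuel' S (reduce h g)
    else Some h
  else None.

(* Buchberger's algorithm: adjoin the nonzero normal forms of all S-polynomials
   until there are none left. *)
Fixpoint buchberger (fuel : nat) S : option (seq {mpoly K[N]}) :=
  if fuel is fuel'.+1 then
    let H := [seq normal_form fuel' S (spoly f g) | f <- S, g <- S] in
    if None \in H then None
    else let H' := [seq h <- pmap id H | h != 0] in
      if H' is [::] then Some S else buchberger fuel' (S ++ H')
  else None.

End StandardBases.

Section OrbitEq.
Variables (K : fieldType) (m n s k : nat).

(* The variables U_{ija}, V_{ija}, G_{ij} and H_{ia}. *)
Definition Uindex : finType := ('I_m * 'I_m * 'X_{1..s < k.+1})%type.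
Definition Vindex : finType := ('I_n * 'I_n * 'X_{1..s < k.+1})%type.
Definition Gindex : finType := ('I_s * 'I_s)%type.
Definition Hindex : finType := ('I_s * {a : 'X_{1..s < k.+1} | (2 <= mdeg a)%N})%type.
Definition pindex : finType := (Uindex + Vindex + (Gindex + Hindex))%type.

Definition nparam : nat := #|{: pindex}|.

(* K[U, V, G]; the ring K[x, U, V, G] is {mpoly KUVG[s]}. *)
Definition KUVG := {mpoly K[nparam]}.

Definition pvar (v : pindex) : KUVG := 'X_(enum_rank v).
Definition varU i j (a : 'X_{1..s < k.+1}) := pvar (inl (inl (i, j, a))).
Definition varV i j (a : 'X_{1..s < k.+1}) := pvar (inl (inr (i, j, a))).
Definition varG i j := pvar (inr (inl (i, j))).
Definition varH i (a : {a : 'X_{1..s < k.+1} | (2 <= mdeg a)%N}) := pvar (inr (inr (i, a))).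

Definition polyG (i : 'I_s) : {mpoly KUVG[s]} :=
  \sum_(j < s) ((i == j)%:R + varG i j) *: 'X_j
  + \sum_(a : {a : 'X_{1..s < k.+1} | (2 <= mdeg a)%N}) varH i a *: 'X_[val a].

(* The constant term delta_{ij} + U_{ij0} is included in the sum, as a = 0. *)
Definition matU : 'M[{mpoly KUVG[s]}]_m :=
  \matrix_(i, j) ((i == j)%:R + \sum_(a : 'X_{1..s < k.+1}) varU i j a *: 'X_[a]).

Definition matV : 'M[{mpoly KUVG[s]}]_n :=
  \matrix_(i, j) ((i == j)%:R + \sum_(a : 'X_{1..s < k.+1}) varV i j a *: 'X_[a]).

Implicit Types A : 'M[{mpoly K[s]}]_(m, n).

Definition subst_G (p : {mpoly K[s]}) : {mpoly KUVG[s]} :=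
  map_mpoly (@mpolyC nparam K) p \mPo [tuple polyG i | i < s].

Definition matB A : 'M[{mpoly KUVG[s]}]_(m, n) :=
  map_mx (mpoly_jet k) (matU *m map_mx subst_G A *m matV).

Definition coefc A (l : 'I_(ncoord m n s k)) : KUVG := ucoord (matB A) l.

(* K[U, V, G, u]: the variables U, V, G come first. *)
Definition KUVGu := {mpoly K[nparam + ncoord m n s k]}.

Definition emb_param (p : KUVG) : KUVGu :=
  p \mPo [tuple 'X_(lshift (ncoord m n s k) i) | i < nparam].

Definition emb_u (p : {mpoly K[ncoord m n s k]}) : KUVGu :=
  p \mPo [tuple 'X_(rshift nparam l) | l < ncoord m n s k].

(* Inverse of emb_u on the polynomials involving only the variables u. *)
Definition proj_u (p : KUVGu) : {mpoly K[ncoord m n s k]} :=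
  p \mPo [tuple if split i is inr l then 'X_l else 0
         | i < nparam + ncoord m n s k].

(* The generators u_l - c_l(U, V, G) of the ideal D. *)
Definition graph_gens A : seq KUVGu :=
  [seq 'X_(rshift nparam l) - emb_param (coefc A l)
  | l <- enum 'I_(ncoord m n s k)].

Definition elim_part (S : seq KUVGu) : seq {mpoly K[ncoord m n s k]} :=
  [seq proj_u g | g <- S & all (@free_of_first _ _) (msupp g)].

Definition orbitEq (le : rel 'X_{1..nparam + ncoord m n s k}) (fuel : nat) A :
    option (seq {mpoly K[ncoord m n s k]}) :=
  omap elim_part (buchberger le fuel (graph_gens A)).

(* F generates the ideal D \cap K[u] of K[u]. *)
Definition generates_elim_ideal A (F : seq {mpoly K[ncoord m n s k]}) : Prop :=
  forall f, in_ideal F f <-> in_ideal (graph_gens A) (emb_u f).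

End OrbitEq.

Arguments graph_gens {K m n s} k A.

(* Elimination orderings exist: compare the degrees in the first p variables,
   then use degrevlex. *)
Lemma elim_order_exists (p t : nat) : exists le : rel 'X_{1..p + t}, elim_order le.
Proof.
pose d (a : 'X_{1..p + t}) := (\sum_(i < p) a (lshift t i))%N.
have dD a b : d (a + b)%MM = (d a + d b)%N.
  by rewrite -big_split; apply: eq_bigr => i _; rewrite mnmDE.
exists (fun a b => (d a < d b)%N || ((d a == d b) && (a <= b)%O)); split.
- by move=> a b /=; case: ltngtP => //= _; apply: le_total.
- by move=> a b /=; case: ltngtP => //= _; apply: le_anti.
- move=> b a c /=; case: ltngtP => //= [lt_ab _|eq_ab le_ab].
    by case: ltngtP => //= [lt_bc|<-]; rewrite ?(ltn_trans lt_ab lt_bc) ?lt_ab.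
  by rewrite eq_ab; case: ltngtP => //= _; apply: le_trans.
- move=> a b c /=; rewrite !dD ltn_add2r eqn_add2r.
  by case: ltngtP => //= _ le_ab; rewrite lem_add.
- move=> a; have -> : d 0%MM = 0%N by rewrite /d big1 // => i _; rewrite mnm0E.
  by case: ltngtP => //= _; apply: le0x.
move=> a b le_ab /forallP b0.
have db0 : d b = 0%N by apply: big1 => i _; apply/eqP.
have /eqP: d a = 0%N by move: le_ab; rewrite db0 /=; case: eqP.
by rewrite sum_nat_eq0 => /forallP a0; apply/forallP => i; have := a0 i.
Qed.

(* Main.v *)
Require Import Defs.
From HB Require Import structures.
From mathcomp Require Import all_boot all_order all_algebra.
From mathcomp Require Import mpoly.
From mathcomp Require Import boolp.

Set Implicit Arguments.
Unset Strict Implicit.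
Unset Printing Implicit Defensive.

Import Order.TTheory GRing.Theory.
Local Open Scope ring_scope.

(** The orbit of A is the image, under the polynomial map c with components
    c_1, ..., c_t, of the open set where three determinants do not vanish.  Its
    closure is therefore the zero set of the polynomials f in u over the
    algebraic closure with f(c) = 0, while the ideal D of the graph of c meets
    K[u] exactly in the polynomials f over K with f(c) = 0.  The theorem combines
    the following facts.

    - Buchberger's algorithm terminates because the leading monomials it adjoins
      would otherwise violate Dickson's lemma ([buchberger_terminates]), and its
      result is a standard basis because all S-polynomials reduce to zero
      ([buchberger_criterion]).  The criterion is proved by cancelling the top
      terms of a representation f = sum_i c_i x^(a_i) g_i.

    - For an elimination ordering, the elements of a standard basis that do not
      involve U, V, G generate the elimination ideal ([elim_part_generates]), which
      is the kernel of the substitution u = c ([elim_ideal_kernel]).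

    - Relations between the c_l over the algebraic closure are linear combinations
      of relations over K, because the kernel of a matrix is compatible with field
      extensions ([relations_base_change]).

    - Each orbit point is a value of c ([orbit_specB]): an automorphism of K[[x]]
      preserves the maximal ideal and its value at a polynomial is determined by its
      values at the variables, so the k-jet of g.A only depends on the k-jets of U, V
      and of the images of the variables.

    - Conversely each value of c at a point with nonzero determinants lies in the orbit
      ([specB_orbit]).  The matrices U and V are invertible because their
      determinants are power series with nonzero constant term, and x_i |-> G_i
      extends to an automorphism by the formal inverse function theorem
      ([ps_subst_bij]).

    - Hence a polynomial f vanishing on the orbit satisfies f(c) q = 0 at all
      points, where q is the product of the determinants; over an infinite field
      this forces f(c) q = 0 and so f(c) = 0 ([vanishing_on_orbit]). *)

(** * The number of coordinates *)

(** Monomials of degree at most k correspond to the s-tuples with entries in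
    0, ..., k and sum at most k. *)
Lemma card_bmultinom s k : #|{: 'X_{1..s < k.+1}}| = 'C(s + k, k).
Proof.
have -> : 'C(s + k, k) = 'C(s + k, s) by rewrite -(bin_sub (leq_addl s k)) addnK.
rewrite -card_partial_ord_partitions.
pose f (a : 'X_{1..s < k.+1}) : s.-tuple 'I_k.+1 :=
  [tuple inord (a i) | i < s].
have fE (a : 'X_{1..s < k.+1}) i : tnth (f a) i = a i :> nat.
  rewrite tnth_mktuple inordK //.
  have := bmdeg a; rewrite mdegE (bigD1 i) //=; apply: leq_ltn_trans.
  exact: leq_addr.
have f_inj : injective f.
  move=> a b eq_ab; apply/val_inj/mnmP => i.
  by rewrite -!fE eq_ab.
rewrite -(card_codom f_inj) -cardsE; apply: eq_card => t; rewrite !inE.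
have sumE (t' : s.-tuple 'I_k.+1) : (\sum_(i <- t') i = \sum_i tnth t' i)%N.
  by rewrite big_tuple.
apply/codomP/idP => [[a ->]|le_t].
  rewrite sumE (eq_bigr (fun i => a i)) => [|i _]; last exact: fE.
  by rewrite -mdegE -ltnS bmdeg.
have lt_t : (mdeg [multinom (tnth t i : nat) | i < s] < k.+1)%N.
  rewrite ltnS mdegE; under eq_bigr do rewrite mnmE.
  by rewrite -sumE.
exists (BMultinom lt_t); apply/eq_from_tnth => i; apply/val_inj.
by apply: esym; rewrite [LHS]fE mnmE.
Qed.

Lemma ncoordE m n s k : ncoord m n s k = (m * n * 'C(s + k, k))%N.
Proof. by rewrite /ncoord !card_prod !card_ord card_bmultinom. Qed.

(** * Dickson's lemma and well-founded relations *)

(** Repeatedly pass to a position from which on the sequence takes its minimum. *)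
Lemma nat_nondecreasing_subseq (u : nat -> nat) :
  exists sigma : nat -> nat, {homo sigma : i j / (i < j)%N} /\
    {homo u \o sigma : i j / (i <= j)%N}.
Proof.
have minP i : exists j, (i <= j)%N /\ forall l, (i <= l)%N -> (u j <= u l)%N.
  have ex : exists v, `[< exists2 j, (i <= j)%N & u j = v >].
    by exists (u i); apply/asboolP; exists i.
  case: (ex_minnP ex) => v /asboolP [j le_ij <-] min_j.
  exists j; split=> // l le_il; apply: min_j; apply/asboolP; by exists l.
pose next i := projT1 (cid (minP i)).
have nextP i : (i <= next i)%N /\ forall l, (i <= l)%N -> (u (next i) <= u l)%N.
  by rewrite /next; case: cid.
pose sigma i := iteri i (fun _ j => next j.+1) (next 0%N).
exists sigma; split.
  apply: homo_ltn; first exact: ltn_trans.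
  by move=> i /=; case: (nextP (sigma i).+1).
refine (@homo_leq nat (u \o sigma) (fun x y => x <= y)%N leqnn _ _) => [y x z|i].
  exact: leq_trans.
have [b le_b sE] : exists2 b, (b <= sigma i)%N & sigma i = next b.
  case: i => [|i]; first by exists 0%N.
  by exists (sigma i).+1 => //=; have [] := nextP (sigma i).+1.
have [le_s _] := nextP (sigma i).+1; have [_ min_b] := nextP b.
rewrite /= -/(sigma i) sE; apply: min_b; rewrite -sE.
by apply: leq_trans le_b _; apply: ltnW.
Qed.

(** Extract subsequences for one coordinate after the other. *)
Lemma dickson_subseq n (u : nat -> 'X_{1..n}) :
  exists sigma : nat -> nat, {homo sigma : i j / (i < j)%N} /\
    forall i j, (i <= j)%N -> (u (sigma i) <= u (sigma j))%MM.
Proof.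
suff [sigma [s_mono le_s]] : exists sigma : nat -> nat,
    {homo sigma : i j / (i < j)%N} /\
    forall l, l \in enum 'I_n -> forall i j, (i <= j)%N ->
      (u (sigma i) l <= u (sigma j) l)%N.
  exists sigma; split=> // i j le_ij; apply/mnm_lepP => l.
  by apply: le_s; rewrite ?mem_enum.
elim: (enum 'I_n) => [|l ls [sigma [s_mono le_s]]]; first by exists id; split.
have [tau [t_mono le_t]] := nat_nondecreasing_subseq (fun i => u (sigma i) l).
exists (sigma \o tau); split=> [i j lt_ij|l' + i j le_ij].
  by apply: s_mono; apply: t_mono.
rewrite in_cons => /predU1P [->|l'_in]; first exact: le_t.
apply: le_s l'_in _ _ _; move: le_ij; rewrite leq_eqVlt => /predU1P [->//|].
by move/t_mono/ltnW.
Qed.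

Lemma dickson n (u : nat -> 'X_{1..n}) :
  exists i j, (i < j)%N /\ (u i <= u j)%MM.
Proof.
have [sigma [s_mono le_s]] := dickson_subseq u.
by exists (sigma 0%N), (sigma 1%N); split; [apply: s_mono | apply: le_s].
Qed.

(** By dependent choice, an inaccessible element starts an infinite descent. *)
Lemma wf_no_descending (T : Type) (R : T -> T -> Prop) :
  (forall u : nat -> T, ~ forall i, R (u i.+1) (u i)) -> well_founded R.
Proof.
move=> noR x; apply: contrapT => naccx.
have next (y : {y | ~ Acc R y}) : exists z : {y | ~ Acc R y}, R (sval z) (sval y).
  case: y => y naccy /=; apply: contrapT => nz; apply: naccy.
  by constructor=> z Rzy; apply: contrapT => naccz; apply: nz; exists (exist _ z naccz).
pose u i := iter i (fun y => projT1 (cid (next y))) (exist _ x naccx).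
by apply: (noR (fun i => sval (u i))) => i /=; case: cid.
Qed.

(** * Finitely generated ideals *)

Section Ideals.
Variable R : comNzRingType.
Implicit Types (E : seq R) (f g : R).

Lemma in_ideal0 E : in_ideal E 0.
Proof. by exists (fun=> 0); rewrite big1 // => i _; rewrite mul0r. Qed.

Lemma in_idealD E f g : in_ideal E f -> in_ideal E g -> in_ideal E (f + g).
Proof.
move=> [c ->] [d ->]; exists (fun i => c i + d i).
by rewrite -big_split; apply: eq_bigr => i _; rewrite mulrDl.
Qed.

Lemma in_idealM E h f : in_ideal E f -> in_ideal E (h * f).
Proof.
move=> [c ->]; exists (fun i => h * c i).
by rewrite mulr_sumr; apply: eq_bigr => i _; rewrite mulrA.
Qed.

Lemma in_idealB E f g : in_ideal E f -> in_ideal E g -> in_ideal E (f - g).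
Proof.
by move=> Ef Eg; rewrite -mulN1r; apply: in_idealD => //; apply: in_idealM.
Qed.

Lemma in_ideal_mem E g : g \in E -> in_ideal E g.
Proof.
move=> gE; have lt_g : (index g E < size E)%N by rewrite index_mem.
exists (fun i => (i == Ordinal lt_g)%:R).
rewrite (bigD1 (Ordinal lt_g)) //= eqxx mul1r nth_index // big1 ?addr0 //.
by move=> i /negbTE ->; rewrite mul0r.
Qed.

Lemma in_ideal_sum E (I : Type) (r : seq I) (P : pred I) (F : I -> R) :
  (forall i, P i -> in_ideal E (F i)) -> in_ideal E (\sum_(i <- r | P i) F i).
Proof.
by move=> EF; elim/big_ind: _ => //; [apply: in_ideal0 | apply: in_idealD].
Qed.

Lemma in_ideal_trans E E' f :
  (forall g, g \in E -> in_ideal E' g) -> in_ideal E f -> in_ideal E' f.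
Proof.
move=> sub [c ->]; apply: in_ideal_sum => i _.
by apply: in_idealM; apply: sub; apply: mem_nth.
Qed.

End Ideals.

(** * Monomial orderings and leading monomials *)

Record monomial_order (N : nat) (le : rel 'X_{1..N}) : Prop := MonomialOrder {
  mo_total : total le;
  mo_anti : antisymmetric le;
  mo_trans : transitive le;
  mo_add : forall a b c, le a b -> le (a + c)%MM (b + c)%MM;
  mo_ge0 : forall a, le 0%MM a
}.

Lemma elim_order_monomial p t (le : rel 'X_{1..p + t}) :
  elim_order le -> monomial_order le.
Proof. by case. Qed.

Section MonomialOrder.
Variables (K : fieldType) (N : nat) (le : rel 'X_{1..N}).
Hypothesis leP : monomial_order le.
Implicit Types (f g h : {mpoly K[N]}) (E S : seq {mpoly K[N]}).
Implicit Types a b m : 'X_{1..N}.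

Definition mo_lt a b := le a b && (a != b).

Lemma mo_refl a : le a a.
Proof. by have := mo_total leP a a; rewrite orbb. Qed.

Lemma mo_dvd a b : (a <= b)%MM -> le a b.
Proof.
move=> /submK <-; rewrite -[X in le X]add0m; apply: mo_add => //.
exact: mo_ge0.
Qed.

Lemma mo_ltNge a b : mo_lt a b = ~~ le b a.
Proof.
rewrite /mo_lt; have [<-|neq] := eqVneq a b; first by rewrite andbF mo_refl.
rewrite andbT; apply/idP/idP => [le_ab|/negbTE nle].
  by apply: contra neq => le_ba; apply/eqP/(mo_anti leP)/andP.
by have := mo_total leP a b; rewrite nle orbF.
Qed.

Lemma mo_lt_add a b c : mo_lt a b -> mo_lt (a + c)%MM (b + c)%MM.
Proof.
by case/andP=> le_ab neq; rewrite /mo_lt mo_add //= eqm_add2r.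
Qed.

Lemma mo_lt_le_trans b a c : mo_lt a b -> le b c -> mo_lt a c.
Proof.
rewrite !mo_ltNge => nle le_bc; apply: contra nle => le_ca.
exact: (mo_trans leP) le_bc le_ca.
Qed.

Lemma mo_le_lt_trans b a c : le a b -> mo_lt b c -> mo_lt a c.
Proof.
rewrite !mo_ltNge => le_ab; apply: contra => le_ca.
exact: (mo_trans leP) le_ca le_ab.
Qed.

(** An infinite descent would contain, by Dickson's lemma, a monomial dividing
    a later, hence strictly smaller one. *)
Lemma mo_lt_wf : well_founded mo_lt.
Proof.
apply: wf_no_descending => u u_desc.
have [i [j [lt_ij /mo_dvd le_ij]]] := dickson u.
have: mo_lt (u j) (u i).
  have desc l : mo_lt (u (i + l.+1)%N) (u i).
    elim: l => [|l IHl]; first by rewrite addn1.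
    by rewrite addnS; apply: mo_lt_le_trans (u_desc _) _; case/andP: IHl.
  by rewrite -(subnKC lt_ij) addSnnS; apply: desc.
by rewrite mo_ltNge le_ij.
Qed.

Lemma lmon_in f : f != 0 -> lmon le f \in msupp f.
Proof.
rewrite -msupp_eq0 /lmon; elim: (msupp f) => //= a [|b s] IHs _.
  by rewrite /= mo_ge0 // mem_head.
case: ifP => _; first exact: mem_head.
by rewrite in_cons IHs ?orbT.
Qed.

Lemma lmon_ge f a : a \in msupp f -> le a (lmon le f).
Proof.
rewrite /lmon; elim: (msupp f) => //= b s IHs; rewrite in_cons.
set c := foldr _ _ _ in IHs *; case: ifP => [le_cb|nle].
  by case/predU1P => [->|/IHs le_ac]; [apply: mo_refl | apply: (mo_trans leP) le_cb].
case/predU1P => [->|/IHs //].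
by have := mo_total leP b c; rewrite nle orbF.
Qed.

Lemma lcof_neq0 f : f != 0 -> lcof le f != 0.
Proof. by move/lmon_in; rewrite mcoeff_msupp. Qed.

Lemma mcoeff_lmon_gt f a : ~~ le a (lmon le f) -> f@_a = 0.
Proof. by move=> nle; apply/eqP; rewrite mcoeff_eq0; apply: contra nle => /lmon_ge. Qed.

Lemma lmonE f a : f@_a != 0 -> (forall b, f@_b != 0 -> le b a) -> lmon le f = a.
Proof.
move=> fa_neq0 le_a; apply: (mo_anti leP); rewrite lmon_ge ?mcoeff_msupp // andbT.
apply: le_a; rewrite -mcoeff_msupp; apply: lmon_in.
by apply: contraNneq fa_neq0 => ->; rewrite mcoeff0.
Qed.

Lemma mcoeff_term c d f a : (c *: 'X_[d] * f)@_(d + a) = c * f@_a.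
Proof. by rewrite -scalerAl mcoeffZ (mulrC _ f) mcoeffMX. Qed.

Lemma term_supp c d f a : (c *: 'X_[d] * f)@_a != 0 -> le a (d + lmon le f)%MM.
Proof.
rewrite -scalerAl mcoeffZ mulf_eq0 negb_or => /andP[_].
rewrite -mcoeff_msupp mulrC (perm_mem (msuppMX _ _)) => /mapP[b b_f ->].
by rewrite [X in le X]addmC [X in le _ X]addmC; apply: mo_add => //; apply: lmon_ge.
Qed.

(** * Buchberger's criterion *)

(** The predicate P bounds the leading monomials of the summands before they cancel
    against each other, which the sum alone does not determine. *)
Inductive rep S (P : 'X_{1..N} -> Prop) : {mpoly K[N]} -> Prop :=
| rep0 : rep S P 0
| rep_cons c a g f : g \in S -> g != 0 -> P (a + lmon le g)%MM -> rep S P f ->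
    rep S P (c *: 'X_[a] * g + f).

Lemma rep_term S P c a g : g \in S -> g != 0 -> P (a + lmon le g)%MM ->
  rep S P (c *: 'X_[a] * g).
Proof. by move=> *; rewrite -[_ * _]addr0; apply: rep_cons => //; apply: rep0. Qed.

Lemma repD S P f g : rep S P f -> rep S P g -> rep S P (f + g).
Proof.
move=> + Pg; elim=> [|c a h f' hS h_neq0 Ph _ IH]; first by rewrite add0r.
by rewrite -addrA; apply: rep_cons.
Qed.

Lemma repZ S P c f : rep S P f -> rep S P (c *: f).
Proof.
elim=> [|d a h f' hS h_neq0 Ph _ IH]; first by rewrite scaler0; apply: rep0.
by rewrite scalerDr scalerAl scalerA; apply: rep_cons.
Qed.

Lemma rep_impl S (P Q : 'X_{1..N} -> Prop) f :
  (forall a, P a -> Q a) -> rep S P f -> rep S Q f.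
Proof.
move=> PQ; elim=> [|d a h f' hS h_neq0 Ph _ IH]; first exact: rep0.
by apply: rep_cons => //; apply: PQ.
Qed.

Lemma repX S (P Q : 'X_{1..N} -> Prop) d f :
  (forall a, P a -> Q (d + a)%MM) -> rep S P f -> rep S Q ('X_[d] * f).
Proof.
move=> PQ; elim=> [|c a h f' hS h_neq0 Ph _ IH]; first by rewrite mulr0; apply: rep0.
rewrite mulrDr mulrA -scalerAr -mpolyXD; apply: rep_cons => //.
by rewrite -addmA; apply: PQ.
Qed.

Lemma rep_supp S P f a : rep S P f -> f@_a != 0 -> exists2 b, P b & le a b.
Proof.
elim=> [|c b g f' gS g_neq0 Pb _ IH]; first by rewrite mcoeff0 eqxx.
rewrite mcoeffD; have [->|] := eqVneq (f'@_a) 0; last by move=> /IH.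
rewrite addr0 => /term_supp le_a.
by exists (b + lmon le g)%MM.
Qed.

Lemma ideal_rep S f : in_ideal S f -> rep S (fun=> True) f.
Proof.
move=> [c ->]; elim/big_ind: _ => [||i _]; [exact: rep0 | exact: repD |].
have [->|g_neq0] := eqVneq (S`_i) 0; first by rewrite mulr0; apply: rep0.
rewrite [c i]mpolyE mulr_suml; elim/big_ind: _ => [||a _].
- exact: rep0.
- exact: repD.
by apply: rep_term => //; apply: mem_nth.
Qed.

Lemma rep_bounded S P f : rep S P f ->
  f = 0 \/ exists2 m, P m & rep S (fun a => le a m) f.
Proof.
elim=> [|c b g f' gS g_neq0 Pb _ IH]; first by left.
right; set m := (b + lmon le g)%MM.
case: IH => [->|[m' Pm' rf']].
  by exists m => //; rewrite addr0; apply: rep_term; rewrite ?(mo_refl m).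
have [le_mm'|le_m'm] := orP (mo_total leP m m').
  by exists m' => //; apply: rep_cons.
exists m => //; apply: rep_cons => //; first exact: mo_refl m.
by apply: rep_impl rf' => a le_am'; apply: (mo_trans leP) le_m'm.
Qed.

Lemma mcoeff_reduce h g : g != 0 -> (lmon le g <= lmon le h)%MM ->
  (reduce le h g)@_(lmon le h) = 0.
Proof.
move=> g_neq0 dvd; rewrite mcoeffB.
rewrite -[X in _ - _@_X](submK dvd) mcoeff_term divfK ?subrr //.
exact: lcof_neq0.
Qed.

Lemma reduce_supp h g a : (lmon le g <= lmon le h)%MM ->
  (reduce le h g)@_a != 0 -> le a (lmon le h).
Proof.
move=> dvd; apply: contraR => nle; rewrite mcoeffB mcoeff_lmon_gt // sub0r oppr_eq0.
by apply: contraR nle => /term_supp; rewrite submK.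
Qed.

Lemma lmon_reduce h g : g != 0 -> (lmon le g <= lmon le h)%MM ->
  reduce le h g != 0 -> mo_lt (lmon le (reduce le h g)) (lmon le h).
Proof.
move=> g_neq0 dvd r_neq0; have r_in := lmon_in r_neq0.
rewrite mcoeff_msupp in r_in; rewrite /mo_lt (reduce_supp dvd r_in) /=.
by apply: contraNneq r_in => ->; rewrite mcoeff_reduce.
Qed.

Lemma normal_form0_rep fuel S h : normal_form le fuel S h = Some 0 ->
  rep S (fun a => le a (lmon le h)) h.
Proof.
elim: fuel h => //= fuel IH h.
have [-> _|h_neq0] := eqVneq h 0; first exact: rep0.
case E: [seq _ <- _ | _] => [|g s] nf.
  by case: nf h_neq0 => ->; rewrite eqxx.
have: g \in [seq g <- S | (g != 0) && (lmon le g <= lmon le h)%MM] by rewrite E mem_head.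
rewrite mem_filter -andbA => /and3P[g_neq0 dvd gS].
have -> : h = (lcof le h / lcof le g) *: 'X_[(lmon le h - lmon le g)%MM] * g
            + reduce le h g by rewrite /reduce addrC subrK.
apply: rep_cons => //.
  set r := _ + _; have -> : r = h by rewrite /r /reduce addrC subrK.
  by rewrite submK // mo_refl.
set r := _ + _; have -> : r = h by rewrite /r /reduce addrC subrK.
have [->|r_neq0] := eqVneq (reduce le h g) 0; first exact: rep0.
apply: rep_impl (IH _ nf) => a le_a; apply: (mo_trans leP) le_a _.
by case/andP: (lmon_reduce g_neq0 dvd r_neq0).
Qed.

Lemma spoly_lmon f g : f != 0 -> g != 0 -> spoly le f g != 0 ->
  mo_lt (lmon le (spoly le f g)) (mlcm (lmon le f) (lmon le g)).
Proof.
move=> f_neq0 g_neq0 s_neq0; set l := mlcm _ _.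
have := lmon_in s_neq0; set a := lmon le _; rewrite mcoeff_msupp mcoeffB -/l => sa.
have df : (lmon le f <= l)%MM := lem_mlcml _ _.
have dg : (lmon le g <= l)%MM := lem_mlcmr _ _.
apply/andP; split.
  have [E0|] := eqVneq ((lcof le g *: 'X_[(l - lmon le f)%MM] * f)@_a) 0.
    by move: sa; rewrite E0 sub0r oppr_eq0 => /term_supp; rewrite submK.
  by move=> /term_supp; rewrite submK.
apply: contraNneq sa => ->; rewrite -[X in _@_X - _](submK df) -[X in _ - _@_X](submK dg).
by rewrite !mcoeff_term mulrC subrr.
Qed.

Definition spolys_rep S := forall f g, f \in S -> g \in S ->
  rep S (fun a => le a (lmon le (spoly le f g))) (spoly le f g).

(** With l the least common multiple of the leading monomials of g and g0, this
    difference is a scalar times x^(m - l) times their S-polynomial, whose leading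
    monomial is smaller than l. *)
Lemma rep_spoly_cancel S c a g g0 : spolys_rep S ->
    g \in S -> g0 \in S -> g != 0 -> g0 != 0 ->
    (lmon le g0 <= a + lmon le g)%MM ->
  let m := (a + lmon le g)%MM in
  rep S (mo_lt^~ m) (c *: 'X_[a] * g
                     - (c * lcof le g / lcof le g0) *: 'X_[(m - lmon le g0)%MM] * g0).
Proof.
move=> S_closed gS g0S g_neq0 g0_neq0 dvd0 m.
set l := mlcm (lmon le g) (lmon le g0).
have dvd_l : (l <= m)%MM by rewrite lem_mlcm dvd0 andbT lem_addl.
have dvd_g : (lmon le g <= l)%MM := lem_mlcml _ _.
have dvd_g0 : (lmon le g0 <= l)%MM := lem_mlcmr _ _.
have shift e : (e <= l)%MM -> (m - l + (l - e))%MM = (m - e)%MM.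
  by move=> dvd_e; rewrite addmBA // submK.
have -> : c *: 'X_[a] * g
          - (c * lcof le g / lcof le g0) *: 'X_[(m - lmon le g0)%MM] * g0
        = (c / lcof le g0) *: ('X_[(m - l)%MM] * spoly le g g0).
  rewrite /spoly -/l mulrBr !mulrA -!scalerAr -!mpolyXD !shift // addmK.
  rewrite scalerBr -!scalerAl !scalerA divfK ?lcof_neq0 //.
  by rewrite [c * _ * _]mulrAC.
apply: repZ; have [->|s_neq0] := eqVneq (spoly le g g0) 0.
  by rewrite mulr0; apply: rep0.
apply: repX (S_closed _ _ gS g0S) => b le_b.
rewrite addmC -[X in mo_lt _ X](submK dvd_l) [X in mo_lt _ X]addmC.
have := mo_lt_add (m - l)%MM (mo_le_lt_trans le_b (spoly_lmon g_neq0 g0_neq0 s_neq0)).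
by rewrite [(l + _)%MM]addmC.
Qed.

(** If g0 has the leading monomial needed to cancel the x^m term of f, then doing
    so lowers all the terms of a representation of f simultaneously: the terms
    at m differ from multiples of g0 by multiples of S-polynomials. *)
Lemma rep_cancel_top S m f g0 : spolys_rep S ->
    g0 \in S -> g0 != 0 -> (lmon le g0 <= m)%MM -> rep S (le^~ m) f ->
  rep S (mo_lt^~ m) (f - (f@_m / lcof le g0) *: 'X_[(m - lmon le g0)%MM] * g0).
Proof.
move=> S_closed g0S g0_neq0 dvd0; elim=> [|c a g f' gS g_neq0 le_am _ IH].
  by rewrite mcoeff0 mul0r scale0r mul0r subr0; apply: rep0.
rewrite mcoeffD !mulrDl scalerDl mulrDl opprD addrACA; apply: repD => //.
have [def_m|neq_m] := eqVneq (a + lmon le g)%MM m.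
  move: dvd0; rewrite -def_m mcoeff_term => dvd0.
  exact: rep_spoly_cancel.
have lt_am : mo_lt (a + lmon le g)%MM m by rewrite /mo_lt le_am.
have -> : (c *: 'X_[a] * g)@_m = 0.
  apply: contraTeq lt_am => /term_supp; rewrite mo_ltNge negbK; exact.
by rewrite mul0r scale0r mul0r subr0; apply: rep_term.
Qed.

Lemma rep_ndvd S m f : (forall g, g \in S -> g != 0 -> ~~ (lmon le g <= m)%MM) ->
  rep S (le^~ m) f -> rep S (mo_lt^~ m) f.
Proof.
move=> ndvd; elim=> [|c a g f' gS g_neq0 le_am _ IH]; first exact: rep0.
apply: rep_cons => //; rewrite /mo_lt le_am /=.
by apply: contraNneq (ndvd g gS g_neq0) => <-; apply: lem_addl.
Qed.

(** Choose a representation of f whose largest term m is minimal.  If m were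
    not the leading monomial of f, its terms would cancel and could be lowered. *)
Lemma buchberger_criterion S f : spolys_rep S -> in_ideal S f -> f != 0 ->
  exists g, [/\ g \in S, g != 0 & (lmon le g <= lmon le f)%MM].
Proof.
move=> S_closed /ideal_rep/rep_bounded [->|[m _ rf] f_neq0]; first by rewrite eqxx.
elim: m / (mo_lt_wf m) rf => m _ IH rf.
have low : rep S (mo_lt^~ m) f ->
    exists g, [/\ g \in S, g != 0 & (lmon le g <= lmon le f)%MM].
  by case/rep_bounded => [f0|[m' lt_m' /IH]]; [rewrite f0 eqxx in f_neq0 | apply].
have [[g0 [g0S g0_neq0 dvd0]]|ndvd] :=
    pselect (exists g, [/\ g \in S, g != 0 & (lmon le g <= m)%MM]).
  have [fm0|fm_neq0] := eqVneq f@_m 0.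
    apply: low; have := rep_cancel_top S_closed g0S g0_neq0 dvd0 rf.
    by rewrite fm0 mul0r scale0r mul0r subr0.
  exists g0; split=> //; rewrite (lmonE fm_neq0) // => b /(rep_supp rf)[b' le_b'].
  by move=> /(mo_trans leP); apply.
apply: low; apply: rep_ndvd rf => g gS g_neq0.
by apply/negP => dvd; apply: ndvd; exists g.
Qed.

(** * Correctness and termination of the algorithm *)

Lemma normal_form_ideal fuel S h r : normal_form le fuel S h = Some r ->
  in_ideal S h -> in_ideal S r.
Proof.
elim: fuel h => //= fuel IH h; case: eqP => [_ [<-]//|_].
case E: [seq _ <- _ | _] => [|g s] nf hS; first by case: nf => <-.
apply: IH nf _.
have: g \in [seq g <- S | (g != 0) && (lmon le g <= lmon le h)%MM] by rewrite E mem_head.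
rewrite mem_filter => /andP[_ gS].
by apply: in_idealB => //; apply: in_idealM; apply: in_ideal_mem.
Qed.

Lemma normal_form_irreducible fuel S h r : normal_form le fuel S h = Some r ->
  r != 0 -> forall g, g \in S -> g != 0 -> ~~ (lmon le g <= lmon le r)%MM.
Proof.
elim: fuel h => //= fuel IH h; case: eqP => [-> [<-]|_]; first by rewrite eqxx.
case E: [seq _ <- _ | _] => [|g s]; last exact: IH.
case=> <- _ g gS g_neq0; apply/negP => dvd.
have: g \in [seq g <- S | (g != 0) && (lmon le g <= lmon le h)%MM].
  by rewrite mem_filter g_neq0 dvd.
by rewrite E.
Qed.

Lemma normal_form_terminates S h :
  exists r N, forall fuel, (N <= fuel)%N -> normal_form le fuel S h = Some r.
Proof.
move: {2}(lmon le h) (erefl (lmon le h)) => a.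
elim: a / (mo_lt_wf a) h => a _ IH h def_a.
have [->|h_neq0] := eqVneq h 0.
  by exists 0, 1%N => -[|fuel] //= _; rewrite eqxx.
case E: [seq g <- S | (g != 0) && (lmon le g <= lmon le h)%MM] => [|g s].
  by exists h, 1%N => -[|fuel] //= _; rewrite (negbTE h_neq0) E.
have [g_neq0 dvd] : g != 0 /\ (lmon le g <= lmon le h)%MM.
  have: g \in [seq g <- S | (g != 0) && (lmon le g <= lmon le h)%MM] by rewrite E mem_head.
  by rewrite mem_filter -andbA => /and3P[].
have [r [M nfM]] : exists r N, forall fuel, (N <= fuel)%N ->
    normal_form le fuel S (reduce le h g) = Some r.
  have [->|r_neq0] := eqVneq (reduce le h g) 0.
    by exists 0, 1%N => -[|fuel] //= _; rewrite eqxx.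
  by apply: IH (erefl _); rewrite -def_a; apply: lmon_reduce.
by exists r, M.+1 => -[|fuel] //=; rewrite (negbTE h_neq0) E; apply: nfM.
Qed.

Lemma normal_forms_terminate S (hs : seq {mpoly K[N]}) :
  exists rs M, forall fuel, (M <= fuel)%N ->
    [seq normal_form le fuel S h | h <- hs] = [seq Some r | r <- rs].
Proof.
elim: hs => [|h hs [rs [M nfM]]]; first by exists [::], 0%N.
have [r [M' nfM']] := normal_form_terminates S h.
exists (r :: rs), (maxn M M') => fuel; rewrite geq_max => /andP[le_M le_M'] /=.
by rewrite nfM // nfM'.
Qed.

Lemma buchberger_basis fuel S F : buchberger le fuel S = Some F ->
  [/\ {subset S <= F}, forall g, g \in F -> in_ideal S g & spolys_rep F].
Proof.
elim: fuel S => //= fuel IH S; set H := [seq _ | f <- S, g <- S].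
case: ifP => // noNone; set H' := [seq _ <- _ | _].
have HP f g : f \in S -> g \in S -> exists2 h, h \in pmap id H &
    normal_form le fuel S (spoly le f g) = Some h.
  move=> fS gS; have: normal_form le fuel S (spoly le f g) \in H by apply: allpairs_f.
  case: (normal_form _ _ _ _) (noNone) => [h _ hH|-> //].
  by exists h; rewrite // mem_pmap map_id.
case E: H' => [|h0 s0]; first case=> <-.
  split=> // [g|f g fS gS]; first exact: in_ideal_mem.
  have [h hH nf] := HP f g fS gS.
  have h0 : h = 0.
    apply/eqP/negPn/negP => h_neq0.
    have: h \in H' by rewrite mem_filter h_neq0.
    by rewrite E.
  by apply: (normal_form0_rep (fuel := fuel)); rewrite nf h0.
rewrite -E => /IH {IH}[sub ideal closed]; split=> // [g gS|g /ideal].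
  by apply: sub; rewrite mem_cat gS.
apply: in_ideal_trans => h; rewrite mem_cat => /orP[|]; first exact: in_ideal_mem.
rewrite mem_filter mem_pmap map_id => /andP[_ /allpairsP[[f g'] /= [fS gS nf]]].
apply: (normal_form_ideal (esym nf)).
by apply: in_idealB; apply: in_idealM; apply: in_ideal_mem.
Qed.

Lemma buchberger_standard_basis fuel S F : buchberger le fuel S = Some F ->
  standard_basis le S F.
Proof.
case/buchberger_basis => sub ideal closed; split=> // f Sf.
apply: buchberger_criterion => //.
by apply: in_ideal_trans Sf => g /sub; apply: in_ideal_mem.
Qed.

Definition enlarges S' S := exists H, S' = S ++ H /\ exists2 h, h \in H &
  h != 0 /\ forall g, g \in S -> g != 0 -> ~~ (lmon le g <= lmon le h)%MM.

(** Along an infinite chain, the leading monomials of the new elements would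
    contradict Dickson's lemma. *)
Lemma enlarges_wf : well_founded enlarges.
Proof.
apply: wf_no_descending => u chain.
have new i : exists h, [/\ h \in u i.+1, h != 0 &
    forall g, g \in u i -> g != 0 -> ~~ (lmon le g <= lmon le h)%MM].
  have [H [-> [h hH [h_neq0 ndvd]]]] := chain i.
  by exists h; rewrite mem_cat hH orbT.
pose h i := projT1 (cid (new i)).
have hP i : [/\ h i \in u i.+1, h i != 0 &
    forall g, g \in u i -> g != 0 -> ~~ (lmon le g <= lmon le (h i))%MM].
  by rewrite /h; case: cid.
have sub i l : {subset u i <= u (i + l)%N}.
  elim: l => [|l IHl] g; first by rewrite addn0.
  rewrite addnS => /IHl; have [H [-> _]] := chain (i + l)%N.
  by rewrite mem_cat => ->.
have [i [j [lt_ij dvd]]] := dickson (fun i => lmon le (h i)).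
have [hi_in hi_neq0 _] := hP i; have [_ _ /(_ (h i))] := hP j.
by rewrite dvd hi_neq0 -(subnKC lt_ij) => /(_ (sub _ _ _ hi_in) isT).
Qed.

Lemma buchberger_terminates S :
  exists F M, forall fuel, (M <= fuel)%N -> buchberger le fuel S = Some F.
Proof.
elim: S / (enlarges_wf S) => S _ IH.
have [rs [M nfM]] := normal_forms_terminate S [seq spoly le f g | f <- S, g <- S].
have HE fuel : (M <= fuel)%N ->
    [seq normal_form le fuel S (spoly le f g) | f <- S, g <- S] = map some rs.
  by move=> /nfM; rewrite map_allpairs.
have noNone : (None \in map some rs) = false by apply/negbTE/mapP => -[].
have pmapE : pmap id (map some rs) = rs by elim: (rs) => //= r rs' ->.
case E: [seq h <- rs | h != 0] => [|h0 s0].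
  exists S, M.+1 => -[|fuel] //= le_M.
  by rewrite HE // noNone pmapE E.
have enl : enlarges (S ++ [seq h <- rs | h != 0]) S.
  exists [seq h <- rs | h != 0]; split=> //; exists h0; first by rewrite E mem_head.
  have: h0 \in [seq h <- rs | h != 0] by rewrite E mem_head.
  rewrite mem_filter => /andP[h0_neq0 h0_rs]; split=> //.
  have /mapP[h _ nf] : Some h0 \in [seq normal_form le M S h | h <-
      [seq spoly le f g | f <- S, g <- S]] by rewrite nfM // map_f.
  exact: normal_form_irreducible (esym nf) h0_neq0.
have [F [M' bM']] := IH _ enl.
exists F, (maxn M M').+1 => -[|fuel] //=; rewrite ltnS geq_max => /andP[le_M le_M'].
by rewrite HE // noNone pmapE E -E bM'.
Qed.

End MonomialOrder.

(** * Elimination *)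

Lemma mpoly_morph_eq n (R : nzRingType) (S : nzRingType)
    (phi psi : {rmorphism {mpoly R[n]} -> S}) :
  (forall c, phi c%:MP = psi c%:MP) -> (forall i, phi 'X_i = psi 'X_i) ->
  phi =1 psi.
Proof.
move=> eqC eqX; elim/mpolyind => [|c a q _ _ IH]; first by rewrite !rmorph0.
rewrite !rmorphD IH -mul_mpolyC !rmorphM eqC; congr (_ * _ + _).
by rewrite mpolyXE_id !rmorph_prod; apply: eq_bigr => i _; rewrite !rmorphXn eqX.
Qed.

Lemma comp_mpolyA (R : comNzRingType) n1 n2 n3 (p : {mpoly R[n1]})
    (u : n1.-tuple {mpoly R[n2]}) (v : n2.-tuple {mpoly R[n3]}) :
  (p \mPo u) \mPo v = p \mPo [tuple tnth u i \mPo v | i < n1].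
Proof.
apply: (mpoly_morph_eq (phi := comp_mpoly v \o comp_mpoly u)
                       (psi := comp_mpoly [tuple tnth u i \mPo v | i < n1])) => [c|i] /=.
  by rewrite !comp_mpolyC.
by rewrite !comp_mpolyXU -!tnth_nth tnth_mktuple.
Qed.

(** The elements q congruent to e(q) form a subalgebra. *)
Lemma in_ideal_congr (R : comNzRingType) N (E : seq {mpoly R[N]})
    (e : {rmorphism {mpoly R[N]} -> {mpoly R[N]}}) :
  (forall c, e c%:MP = c%:MP) -> (forall i, in_ideal E ('X_i - e 'X_i)) ->
  forall q, in_ideal E (q - e q).
Proof.
move=> eC eX.
have closedM q1 q2 : in_ideal E (q1 - e q1) -> in_ideal E (q2 - e q2) ->
    in_ideal E (q1 * q2 - e (q1 * q2)).
  move=> D1 D2; rewrite rmorphM.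
  have -> : q1 * q2 - e q1 * e q2 = q1 * (q2 - e q2) + e q2 * (q1 - e q1).
    by rewrite !mulrBr [e q2 * q1]mulrC addrA subrK [e q2 * e q1]mulrC.
  by apply: in_idealD; apply: in_idealM.
elim/mpolyind=> [|c a q _ _ IH]; first by rewrite rmorph0 subrr; apply: in_ideal0.
rewrite rmorphD opprD addrACA; apply: in_idealD; last exact: IH.
rewrite -mul_mpolyC; apply: (closedM); first by rewrite eC subrr; apply: in_ideal0.
rewrite mpolyXE_id.
apply: (big_ind (fun x => in_ideal E (x - e x))) => [||i _].
- by rewrite rmorph1 subrr; apply: in_ideal0.
- exact: (closedM).
elim: (a i) => [|d IHd]; first by rewrite expr0 rmorph1 subrr; apply: in_ideal0.
by rewrite exprS; apply: (closedM).
Qed.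

Section Elimination.
Variables (K : fieldType) (m n s k : nat) (A : 'M[{mpoly K[s]}]_(m, n)).

Local Notation p := (nparam m n s k).
Local Notation t := (ncoord m n s k).
Local Notation D := (graph_gens k A).
Implicit Types (f : {mpoly K[t]}) (q g : KUVGu K m n s k).

Definition subst_u q : KUVG K m n s k :=
  q \mPo [tuple match split i with inl j => 'X_j | inr l => coefc A l end | i < p + t].

Lemma subst_u_param (r : KUVG K m n s k) : subst_u (emb_param r) = r.
Proof.
rewrite /subst_u /emb_param comp_mpolyA -[RHS]comp_mpoly_id.
congr (_ \mPo _); apply/eq_from_tnth => i; rewrite !tnth_mktuple.
by rewrite comp_mpolyXU -tnth_nth tnth_mktuple (unsplitK (inl i)).
Qed.

Lemma subst_u_u f : subst_u (emb_u f) = f \mPo [tuple coefc A l | l < t].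
Proof.
rewrite /subst_u /emb_u comp_mpolyA.
congr (_ \mPo _); apply/eq_from_tnth => l; rewrite !tnth_mktuple.
by rewrite comp_mpolyXU -tnth_nth tnth_mktuple (unsplitK (inr l)).
Qed.

Lemma proj_emb_u f : proj_u (emb_u f) = f.
Proof.
rewrite /proj_u /emb_u comp_mpolyA -[RHS]comp_mpoly_id.
congr (_ \mPo _); apply/eq_from_tnth => l; rewrite !tnth_mktuple.
by rewrite comp_mpolyXU -tnth_nth tnth_mktuple (unsplitK (inr l)).
Qed.

(** u_l is congruent to c_l modulo D. *)
Lemma subst_u_congr q : in_ideal D (q - emb_param (subst_u q)).
Proof.
pose e : {rmorphism _ -> _} :=
  comp_mpoly [tuple 'X_(lshift t i) : KUVGu K m n s k | i < p]
  \o comp_mpoly [tuple match split i with inl j => 'X_j : KUVG K m n s k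
                       | inr l => coefc A l end | i < p + t].
apply: (in_ideal_congr (e := e)) => [c|i]; first by rewrite /e /= !comp_mpolyC.
rewrite /e /= comp_mpolyXU -tnth_nth tnth_mktuple.
case: splitP => j def_i.
  have -> : i = lshift t j by apply/val_inj.
  rewrite comp_mpolyXU -tnth_nth tnth_mktuple subrr.
  exact: in_ideal0.
have -> : i = rshift p j by apply/val_inj.
by apply: in_ideal_mem; apply/mapP; exists j; rewrite ?mem_enum.
Qed.

(** D is the ideal of the graph of c, so it meets K[u] in the kernel of the
    substitution of c for u. *)
Lemma elim_ideal_kernel f :
  in_ideal D (emb_u f) <-> f \mPo [tuple coefc A l | l < t] = 0.
Proof.
rewrite -subst_u_u; split=> [[c ->]|E].
  rewrite /subst_u rmorph_sum big1 // => i _; rewrite rmorphM /=.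
  have /mapP[l _ ->] := mem_nth 0 (ltn_ord i).
  rewrite rmorphB /= -!/(subst_u _) subst_u_param /subst_u.
  by rewrite comp_mpolyXU -tnth_nth tnth_mktuple (unsplitK (inr l)) subrr mulr0.
by rewrite -[emb_u f](subrK (emb_param (subst_u (emb_u f)))) {2}E;
   rewrite /emb_param comp_mpoly0 addr0; apply: subst_u_congr.
Qed.

Lemma emb_u_free f : all (@free_of_first p t) (msupp (emb_u f)).
Proof.
apply/allP => b; rewrite /emb_u comp_mpolyEX => /msupp_sum_le.
rewrite filter_predT => /flattenP[_ /mapP[a _ ->]] /msuppZ_le.
rewrite comp_mpolyX; under eq_bigr do rewrite tnth_mktuple.
rewrite mprodXnE msuppX inE => /eqP ->.
apply/forallP => i; rewrite mnm_sumE big1 // => l _.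
by rewrite mulmnE mnm1E eq_rlshift.
Qed.

Lemma emb_proj_u g : all (@free_of_first p t) (msupp g) -> emb_u (proj_u g) = g.
Proof.
move=> /allP g_free; rewrite /emb_u /proj_u comp_mpolyA [in RHS](mpolyE g).
rewrite comp_mpolyEX !big_seq; apply: eq_bigr => a /g_free /forallP a_free.
congr (_ *: _); rewrite comp_mpolyX mpolyXE_id; apply: eq_bigr => i _.
rewrite !tnth_mktuple; case: splitP => j def_i.
  have -> : i = lshift t j by apply/val_inj.
  by rewrite (eqP (a_free j)) !expr0.
have -> : i = rshift p j by apply/val_inj.
by rewrite comp_mpolyXU -tnth_nth tnth_mktuple.
Qed.

Variable le : rel 'X_{1..p + t}.
Hypothesis le_elim : elim_order le.
Let leP := elim_order_monomial le_elim.

(** If the leading monomial of g involves no eliminated variable, then g itself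
    involves none; so division by S of an element of K[u] only ever uses the
    elements of S that lie in K[u]. *)
Lemma elim_part_generates S : standard_basis le D S -> generates_elim_ideal A (elim_part S).
Proof.
move=> [S_ideal S_lead] f; split=> [[c ->]|].
  rewrite /emb_u rmorph_sum; apply: in_ideal_sum => i _.
  rewrite rmorphM /=; apply: in_idealM; rewrite -/(emb_u _).
  have /mapP[g + ->] := mem_nth 0 (ltn_ord i).
  by rewrite mem_filter => /andP[g_free gS]; rewrite emb_proj_u //; apply: S_ideal.
have [f0 _|] := eqVneq (emb_u f) 0.
  by rewrite -[f]proj_emb_u f0 /proj_u comp_mpoly0; apply: in_ideal0.
move: {2}(lmon le (emb_u f)) (erefl (lmon le (emb_u f))) => a.
elim: a / (mo_lt_wf leP a) f => a _ IH f def_a f_neq0 Df.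
have [g [gS g_neq0 dvd]] := S_lead _ Df f_neq0.
have free_lf : free_of_first (lmon le (emb_u f)).
  exact: (allP (emb_u_free f)) (lmon_in leP f_neq0).
have free_dvd b : (b <= lmon le (emb_u f))%MM -> free_of_first b.
  move=> /mnm_lepP le_b; apply/forallP => i; rewrite -leqn0.
  by apply: leq_trans (le_b _) _; rewrite (eqP (forallP free_lf i)).
have g_free : all (@free_of_first p t) (msupp g).
  apply/allP => b /(lmon_ge leP) le_b.
  exact: elim_order_elim le_elim _ _ le_b (free_dvd _ dvd).
set c := lcof le (emb_u f) / lcof le g.
set d := (lmon le (emb_u f) - lmon le g)%MM.
pose x := proj_u (c *: 'X_[d] : KUVGu K m n s k).
have xE : emb_u x = c *: 'X_[d].
  apply: emb_proj_u; apply/allP => b /msuppZ_le; rewrite msuppX inE => /eqP ->.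
  by apply: free_dvd; apply: lem_subr.
pose f' := f - x * proj_u g.
have redE : emb_u f' = reduce le (emb_u f) g.
  rewrite /reduce -/c -/d -xE -[X in _ - _ * X](emb_proj_u g_free) /f' /emb_u.
  by rewrite rmorphB rmorphM.
have Df' : in_ideal D (emb_u f').
  by rewrite redE; apply: in_idealB => //; apply: in_idealM; apply: S_ideal.
have -> : f = f' + x * proj_u g by rewrite /f' subrK.
apply: in_idealD; last first.
  by apply: in_idealM; apply: in_ideal_mem; apply: map_f; rewrite mem_filter g_free.
have [f'0|f'_neq0] := eqVneq (emb_u f') 0.
  by rewrite -[f']proj_emb_u f'0 /proj_u comp_mpoly0; apply: in_ideal0.
apply: (IH (lmon le (emb_u f'))) => //.
by rewrite -def_a redE; apply: lmon_reduce; rewrite -?redE.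
Qed.

End Elimination.

(** * Polynomial identities over extension fields *)

(** [muni] regards a polynomial in n + 1 variables as a univariate polynomial in the
    last of them. *)
Section Muni.
Variables (R : comNzRingType) (n : nat).

Local Notation widen := (widen_ord (leqnSn n)).

Lemma muniX_widen (j : 'I_n) : muni ('X_(widen j) : {mpoly R[n.+1]}) = ('X_j)%:P.
Proof.
rewrite /muni mmapX mmap1U; case: splitP => [i /= eq_ij|i /= eq_ji].
  by congr ('X_ _)%:P; apply/val_inj.
by have := ltn_ord j; rewrite eq_ji ltnNge leq_addr.
Qed.

Lemma muniX_max : muni ('X_ord_max : {mpoly R[n.+1]}) = 'X.
Proof.
rewrite /muni mmapX mmap1U; case: splitP => // i /= eq_ni.
by have := ltn_ord i; rewrite -eq_ni ltnn.
Qed.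

Lemma ord_max_or_widen (i : 'I_n.+1) : (exists j, i = widen j) \/ i = ord_max.
Proof.
have [lt_in|le_ni] := ltnP i n; first by left; exists (Ordinal lt_in); apply/val_inj.
by right; apply/val_inj/eqP; rewrite eqn_leq le_ni andbT -ltnS ltn_ord.
Qed.

Lemma muni_inj : injective (@muni n R).
Proof.
pose back : {rmorphism _ -> _} :=
  horner_eval ('X_ord_max : {mpoly R[n.+1]}) \o map_poly (@mwiden n R).
apply: (can_inj (g := back)) => f.
apply: (mpoly_morph_eq (phi := back \o @muni n R) (psi := idfun)) => [c|i] /=.
  by rewrite muniC map_polyC /= mwidenC horner_evalE hornerC.
rewrite horner_evalE; have [[j ->]|->] := ord_max_or_widen i.
  by rewrite muniX_widen map_polyC hornerC /= mwidenX mnmwiden1.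
by rewrite muniX_max map_polyX hornerX.
Qed.

Lemma meval_muni (f : {mpoly R[n.+1]}) (v : 'I_n -> R) (y : R) :
  (map_poly (meval v) (muni f)).[y]
  = f.@[fun i => if unlift ord_max i is Some j then v j else y].
Proof.
set w := fun i => _.
apply: (mpoly_morph_eq (phi := horner_eval y \o map_poly (meval v) \o @muni n R)
                       (psi := meval w)) => [c|i] /=.
  by rewrite muniC map_polyC /= !mevalC horner_evalE hornerC.
rewrite horner_evalE mevalXU; have [[j ->]|->] := ord_max_or_widen i.
  rewrite muniX_widen map_polyC hornerC /= mevalXU /w.
  have -> : widen j = lift ord_max j.
    by apply/val_inj; rewrite /= /bump leqNgt ltn_ord.
  by rewrite liftK.
by rewrite muniX_max map_polyX hornerX /w unlift_none.
Qed.

End Muni.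

(** Evaluate the first n variables: the univariate polynomial that remains has
    infinitely many roots, so its coefficients vanish, and they are polynomials in
    n variables. *)
Lemma mpoly_vanishing (F : closedFieldType) n (f : {mpoly F[n]}) :
  (forall v, f.@[v] = 0) -> f = 0.
Proof.
elim: n f => [|n IH] f f0.
  rewrite [f]nvar0_mpolyC; have := f0 (fun=> 0).
  by rewrite [f in f.@[_]]nvar0_mpolyC mevalC => ->; rewrite mpolyC0.
apply: muni_inj; rewrite rmorph0; apply/polyP => i; rewrite coef0; apply: IH => v.
have: map_poly (meval v) (muni f) = 0.
  apply/eqP/contraT => /closed_nonrootP[y].
  by rewrite /root meval_muni f0 eqxx.
by move/polyP/(_ i); rewrite coef_map coef0.
Qed.

Section BaseChange.
Variables (K L : fieldType) (iota : {rmorphism K -> L}) (p t : nat).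
Variable c : t.-tuple {mpoly K[p]}.

(** The kernel of a matrix is compatible with field extensions; applied to the
    matrix of the K-linear map g |-> g(c) on polynomials g of bounded degree, this
    says that the relations between the c_l over L are L-combinations of those
    over K. *)
Lemma relations_base_change (x : 'I_t -> L) (f : {mpoly L[t]}) :
  (forall g : {mpoly K[t]}, g \mPo c = 0 -> (map_mpoly iota g).@[x] = 0) ->
  f \mPo [tuple map_mpoly iota (tnth c l) | l < t] = 0 -> f.@[x] = 0.
Proof.
move=> relK fc0; set ci := [tuple _ | _ < _] in fc0.
pose T : finType := 'X_{1..t < msize f}.
pose P (a : T) := 'X_[bmnm a] \mPo c.
pose d := \max_(a : T) msize (P a).
pose T' : finType := 'X_{1..p < d}.
pose M : 'M[K]_(#|T|, #|T'|) := \matrix_(i, j) (P (enum_val i))@_(bmnm (enum_val j)).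
pose v : 'rV[L]_#|T| := \row_i f@_(bmnm (enum_val i)).
have PiE (a : T) : 'X_[bmnm a] \mPo ci = map_mpoly iota (P a).
  rewrite /P !comp_mpolyX rmorph_prod; apply: eq_bigr => l _.
  by rewrite rmorphXn /= tnth_mktuple.
have fE : f = \sum_(a : T) f@_(bmnm a) *: 'X_[bmnm a] by apply: mpolywE.
have sumT (V : zmodType) (G : T -> V) : \sum_a G a = \sum_(i < #|T|) G (enum_val i).
  by rewrite -(big_enum_val (A := T) G).
have vM0 : v *m map_mx iota M = 0.
  apply/rowP => j; rewrite !mxE.
  transitivity (f \mPo ci)@_(bmnm (enum_val j)); last by rewrite fc0 mcoeff0.
  rewrite [in RHS]fE rmorph_sum raddf_sum /= sumT; apply: eq_bigr => i _.
  by rewrite !mxE comp_mpolyZ mcoeffZ PiE mcoeff_map_mpoly.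
have /submxP[w] : (v <= kermx (map_mx iota M))%MS by apply/sub_kermxP.
rewrite -map_kermx => vE.
have rel (r : 'I_#|T|) :
    \sum_i iota (kermx M r i) * 'X_[bmnm (enum_val i)].@[x] = 0.
  pose g : {mpoly K[t]} := \sum_i kermx M r i *: 'X_[bmnm (enum_val i)].
  transitivity (map_mpoly iota g).@[x].
    rewrite /g (rmorph_sum (map_mpoly iota)) (rmorph_sum (meval x)); apply: eq_bigr => i _ /=.
    by rewrite map_mpolyZ map_mpolyX mevalZ.
  apply: relK; apply/mpolyP => b.
  rewrite mcoeff0 /g (raddf_sum (comp_mpoly c)) (raddf_sum (mcoeff b)) /=.
  have [lt_bd|le_db] := ltnP (mdeg b) d.
    have /matrixP/(_ r (enum_rank (BMultinom lt_bd : T'))) := mulmx_ker M.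
    rewrite !mxE => E0; rewrite -[RHS]E0; apply: eq_bigr => i _.
    by rewrite comp_mpolyZ mcoeffZ !mxE enum_rankK.
  rewrite big1 // => i _; rewrite comp_mpolyZ mcoeffZ.
  rewrite (memN_msupp_eq0 (m := b)) ?mulr0 //; apply: msize_mdeg_ge.
  by apply: leq_trans le_db; apply: (leq_bigmax (F := fun a => msize (P a))).
rewrite fE (raddf_sum (meval x)) sumT.
transitivity (\sum_i \sum_r w 0 r * (iota (kermx M r i) * 'X_[bmnm (enum_val i)].@[x])).
  apply: eq_bigr => i _; rewrite /= mevalZ.
  have -> : f@_(bmnm (enum_val i)) = v 0 i by rewrite mxE.
  rewrite vE mxE mulr_suml; apply: eq_bigr => r _.
  by rewrite mxE mulrA.
rewrite exchange_big big1 // => r _.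
by rewrite -mulr_sumr rel mulr0.
Qed.

End BaseChange.

(** * Formal power series modulo powers of the maximal ideal *)

Section PowerSeriesCongruence.
Variables (s : nat) (R : comNzRingType).
Implicit Types (f g : mpseries s R) (p q : {mpoly R[s]}) (a b : 'X_{1..s}).

(** Congruence modulo the d-th power of the maximal ideal; [ps_eqm d f 0] says that
    f has order at least d. *)
Definition ps_eqm d f g := forall a, (mdeg a < d)%N -> pscoef f a = pscoef g a.

Lemma pscoefD f g a : pscoef (f + g) a = pscoef f a + pscoef g a. Proof. by []. Qed.
Lemma pscoefN f a : pscoef (- f) a = - pscoef f a. Proof. by []. Qed.
Lemma pscoefZ c f a : pscoef (c *: f) a = c * pscoef f a. Proof. by []. Qed.
Lemma pscoef0 a : pscoef (0 : mpseries s R) a = 0. Proof. by []. Qed.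

Lemma ps_eqm_refl d f : ps_eqm d f f. Proof. by []. Qed.

Lemma ps_eqm_trans d g f h : ps_eqm d f g -> ps_eqm d g h -> ps_eqm d f h.
Proof. by move=> fg gh a lt_ad; rewrite fg // gh. Qed.

Lemma ps_eqm_leq d e f g : (d <= e)%N -> ps_eqm e f g -> ps_eqm d f g.
Proof. by move=> le_de fg a lt_ad; apply: fg; apply: leq_trans le_de. Qed.

Lemma ps_eqm_sub0 d f g : ps_eqm d (f - g) 0 <-> ps_eqm d f g.
Proof.
split=> E a lt_ad; last by rewrite pscoefD pscoefN E ?subrr.
by apply/eqP; rewrite -subr_eq0; apply/eqP; have := E a lt_ad.
Qed.

Lemma ps_eqmD d f f' g g' : ps_eqm d f f' -> ps_eqm d g g' -> ps_eqm d (f + g) (f' + g').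
Proof. by move=> ff gg a lt_ad; rewrite !pscoefD ff // gg. Qed.

Lemma ps_eqmB d f f' g g' : ps_eqm d f f' -> ps_eqm d g g' -> ps_eqm d (f - g) (f' - g').
Proof. by move=> ff gg a lt_ad; rewrite !pscoefD !pscoefN ff // gg. Qed.

Lemma ps_eqmZ d c f f' : ps_eqm d f f' -> ps_eqm d (c *: f) (c *: f').
Proof. by move=> ff a lt_ad; rewrite !pscoefZ ff. Qed.

Lemma ps_eqm_eq f g : (forall d, ps_eqm d f g) -> f = g.
Proof. by move=> E; apply: psP => a; apply: (E (mdeg a).+1). Qed.

Lemma ps_ordM d e f g : ps_eqm d f 0 -> ps_eqm e g 0 -> ps_eqm (d + e) (f * g) 0.
Proof.
move=> f0 g0 a lt_a; rewrite /= big1 // => -[b c] /= /eqP def_a.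
have [lt_bd|le_db] := ltnP (mdeg b) d; first by rewrite f0 // mul0r.
have: (mdeg b + mdeg c < d + e)%N by rewrite -mdegD -def_a.
move=> lt_bc; rewrite g0 ?mulr0 //; move: lt_bc.
by apply: contraLR; rewrite -!leqNgt => le_ec; apply: leq_add.
Qed.

Lemma ps_eqmM d f f' g g' : ps_eqm d f f' -> ps_eqm d g g' -> ps_eqm d (f * g) (f' * g').
Proof.
move=> /ps_eqm_sub0 ff /ps_eqm_sub0 gg; apply/ps_eqm_sub0.
have -> : f * g - f' * g' = (f - f') * g + f' * (g - g').
  by rewrite mulrBl mulrBr addrA subrK.
rewrite -[0]addr0; apply: ps_eqmD.
  by rewrite -[d]addn0; apply: ps_ordM.
by rewrite -[d]add0n; apply: ps_ordM.
Qed.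

Lemma ps_eqm_sum d (I : Type) (r : seq I) (P : pred I) (G H : I -> mpseries s R) :
  (forall i, P i -> ps_eqm d (G i) (H i)) ->
  ps_eqm d (\sum_(i <- r | P i) G i) (\sum_(i <- r | P i) H i).
Proof. by move=> GH; elim/big_rec2: _ => // i f g Pi; apply: ps_eqmD; apply: GH. Qed.

Lemma ps_ord_sum d (I : Type) (r : seq I) (P : pred I) (G : I -> mpseries s R) :
  (forall i, P i -> ps_eqm d (G i) 0) -> ps_eqm d (\sum_(i <- r | P i) G i) 0.
Proof.
by move=> G0; elim/big_ind: _ => // f g f0 g0; rewrite -[0]addr0; apply: ps_eqmD.
Qed.

Lemma ps_eqm_prod d (I : Type) (r : seq I) (P : pred I) (G H : I -> mpseries s R) :
  (forall i, P i -> ps_eqm d (G i) (H i)) ->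
  ps_eqm d (\prod_(i <- r | P i) G i) (\prod_(i <- r | P i) H i).
Proof. by move=> GH; elim/big_rec2: _ => // i f g Pi; apply: ps_eqmM; apply: GH. Qed.

Lemma ps_eqmX d f g e : ps_eqm d f g -> ps_eqm d (f ^+ e) (g ^+ e).
Proof. by move=> fg; elim: e => // e IH; rewrite !exprS; apply: ps_eqmM. Qed.

Lemma ps_jet_eqm k f g : ps_jet k f = ps_jet k g <-> ps_eqm k.+1 f g.
Proof.
split=> [E a lt_ak|fg].
  by have := congr1 (mcoeff a) E; rewrite !mcoeff_ps_jet lt_ak.
by apply/mpolyP => a; rewrite !mcoeff_ps_jet; case: ifP => // /fg.
Qed.

Lemma ps_of_mpoly_additive : zmod_morphism (@ps_of_mpoly s R).
Proof. by move=> p q; apply: psP => a /=; rewrite mcoeffB. Qed.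

Lemma ps_of_mpoly_multiplicative : monoid_morphism (@ps_of_mpoly s R).
Proof.
split=> [|p q]; apply: psP => a; first by rewrite /= mcoeff1.
rewrite (pscoefM _ _ (ltnSn (mdeg a))).
by apply: (mcoeffM_jet (ltnSn (mdeg a))) => b lt_b; rewrite mcoeff_ps_jet lt_b.
Qed.

HB.instance Definition _ := GRing.isZmodMorphism.Build _ _ _ ps_of_mpoly_additive.
HB.instance Definition _ := GRing.isMonoidMorphism.Build _ _ _ ps_of_mpoly_multiplicative.

Lemma ps_of_mpolyZ c p : ps_of_mpoly (c *: p) = c *: ps_of_mpoly p.
Proof. by apply: psP => a /=; rewrite mcoeffZ. Qed.

Lemma ps_of_mpolyC c : ps_of_mpoly (c%:MP : {mpoly R[s]}) = c%:A.
Proof. by rewrite -alg_mpolyC ps_of_mpolyZ rmorph1. Qed.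

Lemma ps_of_jet_eqm k f : ps_eqm k.+1 (ps_of_mpoly (ps_jet k f)) f.
Proof. by move=> a lt_ak; rewrite /= mcoeff_ps_jet lt_ak. Qed.

Definition psX (i : 'I_s) : mpseries s R := ps_of_mpoly 'X_i.

Lemma psX_ord i : ps_eqm 1 (psX i) 0.
Proof.
move=> a; rewrite ltnS leqn0 mdeg_eq0 => /eqP ->.
by rewrite /= mcoeffX mnm1_eq0.
Qed.

Definition ps_const f : R := pscoef f 0%MM.

Lemma ps_const_additive : zmod_morphism ps_const. Proof. by []. Qed.

Lemma ps_const_multiplicative : monoid_morphism ps_const.
Proof.
split=> [|f g]; first by rewrite /ps_const /= eqxx.
rewrite /ps_const (@pscoefM _ _ 0) ?mdeg0 // rmorphM /=.
by rewrite !mcoeff_ps_jet mdeg0.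
Qed.

HB.instance Definition _ := GRing.isZmodMorphism.Build _ _ _ ps_const_additive.
HB.instance Definition _ := GRing.isMonoidMorphism.Build _ _ _ ps_const_multiplicative.

Lemma ps_constA (c : R) : ps_const (c%:A : mpseries s R) = c.
Proof. by rewrite /ps_const /= eqxx mulr1. Qed.

Lemma ps_constX i : ps_const (psX i) = 0.
Proof. by rewrite /ps_const /= mcoeffX mnm1_eq0. Qed.

Lemma ps_const_ord f : ps_const f = 0 <-> ps_eqm 1 f 0.
Proof.
split=> [f0 a|f0]; last by apply: f0; rewrite mdeg0.
by rewrite ltnS leqn0 mdeg_eq0 => /eqP ->.
Qed.

(** The geometric series of -N converges, as N raises the order. *)
Lemma ps_contraction_solve (N : {additive mpseries s R -> mpseries s R}) g :
  (forall d f, ps_eqm d f 0 -> ps_eqm d.+1 (N f) 0) -> exists f, f + N f = g.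
Proof.
move=> N_contr.
(* The iterates u_j are partial sums of the geometric series applied to g, and the
   coefficients of degree less than j are constant from u_j on. *)
pose u := fix u j := if j is j'.+1 then g - N (u j') else 0.
have N_eqm d f f' : ps_eqm d f f' -> ps_eqm d.+1 (N f) (N f').
  by move=> /ps_eqm_sub0 ff; apply/ps_eqm_sub0; rewrite -raddfB; apply: N_contr.
have uS j : ps_eqm j (u j) (u j.+1).
  by elim: j => // j IH; apply: ps_eqmB => //; apply: N_eqm.
have u_cauchy i j : ps_eqm i (u i) (u (i + j)%N).
  elim: j => [|j IH]; first by rewrite addn0.
  apply: ps_eqm_trans IH _; rewrite addnS; apply: ps_eqm_leq (uS _).
  exact: leq_addr.
pose f := MPSeries (fun a => pscoef (u (mdeg a).+1) a).
have f_lim j : ps_eqm j f (u j).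
  move=> a lt_aj; have := @u_cauchy (mdeg a).+1 (j - (mdeg a).+1)%N a (ltnSn _).
  by rewrite subnKC.
exists f; apply: ps_eqm_eq => d.
apply: ps_eqm_leq (leqnSn d) _.
apply: ps_eqm_trans (_ : ps_eqm d.+1 (u d.+1 + N (u d)) g); last by rewrite /= subrK.
by apply: ps_eqmD => //; apply: N_eqm.
Qed.

Lemma ps_contraction_inj (N : {additive mpseries s R -> mpseries s R}) :
  (forall d f, ps_eqm d f 0 -> ps_eqm d.+1 (N f) 0) -> injective (fun f => f + N f).
Proof.
move=> N_contr f g E; apply/eqP; rewrite -subr_eq0; apply/eqP/ps_eqm_eq.
elim=> // d IH; have -> : f - g = - N (f - g).
  by rewrite raddfB opprB; apply/eqP; rewrite subr_eq addrAC eq_sym subr_eq addrC E addrC.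
by move=> a lt_ad; rewrite pscoefN (N_contr d) // oppr0.
Qed.

End PowerSeriesCongruence.

Lemma injective_surjective_bij (T : Type) (f : T -> T) :
  injective f -> (forall y, exists x, f x = y) -> bijective f.
Proof.
move=> f_inj f_surj; exists (fun y => projT1 (cid (f_surj y))) => x.
  by apply: f_inj; case: cid.
by case: cid.
Qed.

Section PowerSeriesField.
Variables (s : nat) (F : fieldType).
Implicit Types (f g : mpseries s F).

(** If f has constant term 1/c then c f = 1 + h with h of positive order, and
    multiplication by h is a contraction. *)
Lemma ps_unit_const f : (f \is a GRing.unit) = (ps_const f != 0).
Proof.
apply/idP/idP => [f_unit|f_neq0].
  by rewrite -unitfE; apply: (rmorph_unit (@ps_const s F)).
pose c := (ps_const f)^-1; pose h := c *: f - 1.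
have [g Eg] : exists g, g + h * g = 1.
  apply: (ps_contraction_solve (N := h \*o idfun)) => d g g0; rewrite -add1n.
  apply: ps_ordM => //; apply/ps_const_ord.
  by rewrite /h rmorphB rmorph1 /ps_const /= mulVf // subrr.
apply/unitrP; exists (c *: g); rewrite [f * _]mulrC.
suff -> : c *: g * f = 1 by [].
by rewrite -Eg mulrBl mul1r addrC subrK -!scalerAl mulrC.
Qed.

Lemma ps_unitmx m (U : 'M[mpseries s F]_m) :
  (U \in unitmx) = (\det (map_mx (@ps_const s F) U) != 0).
Proof. by rewrite unitmxE ps_unit_const det_map_mx. Qed.

(** * Substitution of power series without constant term *)

Section Substitution.
Variable G : 'I_s -> mpseries s F.

Definition ps_eval (p : {mpoly F[s]}) : mpseries s F := mmap (in_alg (mpseries s F)) G p.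

HB.instance Definition _ := GRing.RMorphism.copy ps_eval (mmap (in_alg (mpseries s F)) G).

Hypothesis G0 : forall i, ps_eqm 1 (G i) 0.

Lemma mmap1_ord a : ps_eqm (mdeg a) (mmap1 G a) 0.
Proof.
rewrite mdegE /mmap1; elim/big_rec2: _ => // i d f _ IH.
rewrite mulrC addnC; apply: ps_ordM => //.
elim: (a i) => // e IHe; rewrite exprS -add1n.
by apply: ps_ordM.
Qed.

Lemma ps_eval_ord d p : (forall a, (mdeg a < d)%N -> p@_a = 0) -> ps_eqm d (ps_eval p) 0.
Proof.
move=> p0; rewrite /ps_eval /mmap big_seq.
apply: ps_ord_sum => a.
rewrite mcoeff_msupp => pa; rewrite -[d]add0n; apply: ps_ordM => //.
apply: ps_eqm_leq (@mmap1_ord a); rewrite leqNgt; apply: contraNN pa => /p0 ->.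
by rewrite eqxx.
Qed.

End Substitution.

(** The coefficient of x^a in f(G) only involves the terms of f up to degree |a|, as G
    has no constant term.  The proof [G0] of this is an argument, so that the
    morphism structures below can be inferred from the function. *)
Definition ps_subst (G : 'I_s -> mpseries s F) (G0 : forall i, ps_eqm 1 (G i) 0) f :=
  MPSeries (fun a => pscoef (ps_eval G (ps_jet (mdeg a) f)) a).

Section SubstitutionMorphism.
Variables (G : 'I_s -> mpseries s F) (G0 : forall i, ps_eqm 1 (G i) 0).
Local Notation phi := (ps_subst G0).

(** Any polynomial approximation of f may be used to compute f(G) up to degree d. *)
Lemma ps_subst_eqm d f p : ps_eqm d (ps_of_mpoly p) f -> ps_eqm d (phi f) (ps_eval G p).
Proof.
move=> pf a lt_ad; apply/esym.
have : ps_eqm (mdeg a).+1 (ps_eval G (p - ps_jet (mdeg a) f)) 0.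
  apply: ps_eval_ord => // b lt_ba; rewrite mcoeffB mcoeff_ps_jet lt_ba.
  by rewrite -(pf b) ?subrr //; apply: leq_trans lt_ba _.
by rewrite rmorphB => /ps_eqm_sub0 /(_ a (ltnSn _)).
Qed.

Lemma ps_subst_mpoly p : phi (ps_of_mpoly p) = ps_eval G p.
Proof. by apply: ps_eqm_eq => d; apply: ps_subst_eqm. Qed.

Lemma ps_subst_jet d f : ps_eqm d (phi f) (ps_eval G (ps_jet d f)).
Proof. by apply: ps_subst_eqm; apply: ps_eqm_leq (leqnSn d) (@ps_of_jet_eqm _ _ _ _). Qed.

Lemma ps_subst_additive : zmod_morphism phi.
Proof.
move=> f g; apply: ps_eqm_eq => d.
apply: ps_eqm_trans (ps_subst_eqm (p := ps_jet d f - ps_jet d g) _) _.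
  rewrite rmorphB; apply: ps_eqm_leq (leqnSn d) _.
  by apply: ps_eqmB; apply: ps_of_jet_eqm.
by rewrite rmorphB; apply: ps_eqmB => a lt_ad; rewrite (@ps_subst_jet d).
Qed.

Lemma ps_subst_multiplicative : monoid_morphism phi.
Proof.
split=> [|f g]; first by rewrite -(rmorph1 (@ps_of_mpoly s F)) ps_subst_mpoly !rmorph1.
apply: ps_eqm_eq => d.
apply: ps_eqm_trans (ps_subst_eqm (p := ps_jet d f * ps_jet d g) _) _.
  rewrite rmorphM; apply: ps_eqm_leq (leqnSn d) _.
  by apply: ps_eqmM; apply: ps_of_jet_eqm.
by rewrite rmorphM; apply: ps_eqmM => a lt_ad; rewrite (@ps_subst_jet d).
Qed.

Lemma ps_subst_scalable : scalable phi.
Proof.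
move=> c f; apply: ps_eqm_eq => d.
apply: ps_eqm_trans (ps_subst_eqm (p := c *: ps_jet d f) _) _.
  rewrite ps_of_mpolyZ; apply: ps_eqm_leq (leqnSn d) _.
  by apply: ps_eqmZ; apply: ps_of_jet_eqm.
rewrite /ps_eval mmapZ mulr_algl; apply: ps_eqmZ => a lt_ad.
by rewrite (@ps_subst_jet d).
Qed.

HB.instance Definition _ := GRing.isZmodMorphism.Build _ _ phi ps_subst_additive.
HB.instance Definition _ := GRing.isMonoidMorphism.Build _ _ phi ps_subst_multiplicative.
HB.instance Definition _ := GRing.isScalable.Build F _ _ _ phi ps_subst_scalable.

Lemma ps_subst_ord d f : ps_eqm d f 0 -> ps_eqm d (phi f) 0.
Proof.
move=> f0; apply: ps_eqm_trans (@ps_subst_jet d f) _; apply: ps_eval_ord => // a lt_ad.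
by rewrite mcoeff_ps_jet f0 ?if_same.
Qed.

Lemma ps_substX i : phi (psX F i) = G i.
Proof. by rewrite ps_subst_mpoly /ps_eval mmapX mmap1U. Qed.

End SubstitutionMorphism.

End PowerSeriesField.

(** * Automorphisms of the ring of power series *)

Section UnipotentEndomorphism.
Variables (s : nat) (F : fieldType) (chi : {lrmorphism mpseries s F -> mpseries s F}).
Hypothesis chi_ord : forall d f, ps_eqm d f 0 -> ps_eqm d (chi f) 0.
Hypothesis chiX : forall i, ps_eqm 2 (chi (psX F i)) (psX F i).

Let same_init d (f f' : mpseries s F) := ps_eqm d f' 0 /\ ps_eqm d.+1 f f'.

Let same_initM d e f f' g g' :
  same_init d f f' -> same_init e g g' -> same_init (d + e) (f * g) (f' * g').
Proof.
move=> [f0 /ps_eqm_sub0 ff] [g0 gg]; have g1 : ps_eqm e g 0.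
  exact: ps_eqm_trans (ps_eqm_leq (leqnSn e) gg) g0.
move/ps_eqm_sub0 in gg; split; first exact: ps_ordM.
apply/ps_eqm_sub0; have -> : f * g - f' * g' = (f - f') * g + f' * (g - g').
  by rewrite mulrBl mulrBr addrA subrK.
rewrite -[0]addr0; apply: ps_eqmD; first by rewrite -addSn; apply: ps_ordM.
by rewrite -addnS; apply: ps_ordM.
Qed.

Lemma unipotent_monomial a :
  ps_eqm (mdeg a).+1 (chi (ps_of_mpoly 'X_[a])) (ps_of_mpoly 'X_[a]).
Proof.
suff [] : same_init (mdeg a) (chi (ps_of_mpoly 'X_[a])) (ps_of_mpoly 'X_[a]) by [].
rewrite mpolyXE_id !rmorph_prod mdegE.
elim/big_rec3: _ => [|i f g d _ IH]; first by split.
apply: same_initM => //; rewrite !rmorphXn /= -/(psX F i).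
elim: (a i) => [|e IHe]; first by rewrite !expr0; split.
rewrite !exprS -add1n; apply: same_initM => //; split; first exact: psX_ord.
exact: chiX.
Qed.

(** Modulo higher order, f is a combination of monomials of degree d, on each of which
    chi - 1 raises the degree. *)
Lemma unipotent_contraction d f : ps_eqm d f 0 -> ps_eqm d.+1 (chi f - f) 0.
Proof.
move=> f0; pose p := ps_jet d f; pose h := f - ps_of_mpoly p.
have h0 : ps_eqm d.+1 h 0.
  by apply/ps_eqm_sub0 => a lt_ad; rewrite ps_of_jet_eqm.
have -> : chi f - f = (chi (ps_of_mpoly p) - ps_of_mpoly p) + (chi h - h).
  by rewrite /h rmorphB opprB addrACA addKr addrCA subrr addr0.
rewrite -[0]addr0; apply: ps_eqmD; last first.
  by rewrite -[0]subr0; apply: ps_eqmB => //; apply: chi_ord.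
apply/ps_eqm_sub0; rewrite /p /ps_jet !rmorph_sum; apply: ps_eqm_sum => a _.
rewrite /= !ps_of_mpolyZ linearZ /=; have [lt_ad|le_da] := ltnP (mdeg a) d.
  by rewrite f0 // !scale0r.
by apply: ps_eqmZ; apply: ps_eqm_leq (@unipotent_monomial a); rewrite ltnS.
Qed.

Lemma unipotent_bij : bijective chi.
Proof.
pose N : {additive mpseries s F -> mpseries s F} := chi \- idfun.
have N_contr d f : ps_eqm d f 0 -> ps_eqm d.+1 (N f) 0 by apply: unipotent_contraction.
have chiE f : f + N f = chi f by rewrite /= addrC subrK.
apply: injective_surjective_bij => [f g|g].
  by rewrite -!chiE => /(ps_contraction_inj N_contr).
by have [f] := ps_contraction_solve g N_contr; rewrite chiE; exists f.
Qed.

End UnipotentEndomorphism.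

Section InverseFunction.
Variables (s : nat) (F : fieldType).

Definition linear_subst (M : 'M[F]_s) (i : 'I_s) : mpseries s F := \sum_j M i j *: psX F j.

Lemma linear_subst_ord M i : ps_eqm 1 (linear_subst M i) 0.
Proof.
apply: ps_ord_sum => j _ a lt_a1.
by rewrite pscoefZ psX_ord // pscoef0 mulr0.
Qed.

Definition ps_linear M := ps_subst (linear_subst_ord M).

Definition jacobian (G : 'I_s -> mpseries s F) : 'M[F]_s :=
  \matrix_(i, j) pscoef (G i) U_(j)%MM.

Variables (G : 'I_s -> mpseries s F) (G0 : forall i, ps_eqm 1 (G i) 0).

Lemma jacobian_eqm i : ps_eqm 2 (G i) (linear_subst (jacobian G) i).
Proof.
move=> a; rewrite ltnS leq_eqVlt => /predU1P [deg_a|lt_a1]; last first.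
  by rewrite G0 // linear_subst_ord.
have /mdeg1P[l /eqP ->] : mdeg a == 1%N by rewrite deg_a.
have coef_sum I (r : seq I) (H : I -> mpseries s F) b :
    pscoef (\sum_(x <- r) H x) b = \sum_(x <- r) pscoef (H x) b.
  by elim/big_rec2: _ => // x y f _ <-.
rewrite /linear_subst coef_sum (bigD1 l) //= !mxE mcoeffXU eqxx mulr1.
rewrite big1 ?addr0 // => j /negbTE neq_jl.
by rewrite mcoeffXU neq_jl mulr0.
Qed.

(** The formal inverse function theorem: after a linear change of
    coordinates the Jacobian matrix becomes the identity, and the substitution
    differs from the identity by a contraction. *)
Lemma ps_subst_bij : jacobian G \in unitmx -> bijective (ps_subst G0).
Proof.
move=> J_unit; set J := jacobian G in J_unit.
pose phi : {lrmorphism mpseries s F -> mpseries s F} := ps_subst G0.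
(* The coordinate change psi is surjective because psi \o lam fixes the variables,
   and phi \o psi fixes them modulo terms of order 2. *)
pose psi : {lrmorphism mpseries s F -> mpseries s F} := ps_linear (invmx J).
pose lam : {lrmorphism mpseries s F -> mpseries s F} := ps_linear J.
have psiX j : psi (psX F j) = linear_subst (invmx J) j := ps_substX _ j.
have phiX j : phi (psX F j) = G j := ps_substX _ j.
have composeX (theta : {lrmorphism mpseries s F -> mpseries s F}) M i :
    theta (ps_linear M (psX F i)) = \sum_j M i j *: theta (psX F j).
  rewrite /ps_linear ps_substX /linear_subst linear_sum; apply: eq_bigr => j _.
  by rewrite linearZ.
have linear_mul M M' i : M *m M' = 1%:M ->
    \sum_j M i j *: linear_subst M' j = psX F i.
  move=> MM'; rewrite /linear_subst; under eq_bigr do rewrite scaler_sumr.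
  rewrite exchange_big /= (bigD1 i) //= [X in _ + X]big1 => [|l /negbTE neq_li].
    under eq_bigr do rewrite scalerA.
    rewrite -scaler_suml; have /matrixP/(_ i i) := MM'.
    by rewrite !mxE eqxx => ->; rewrite scale1r addr0.
  under eq_bigr do rewrite scalerA.
  rewrite -scaler_suml; have /matrixP/(_ i l) := MM'.
  by rewrite !mxE eq_sym neq_li => ->; rewrite scale0r.
have psi_surj g : exists f, psi f = g.
  have [] : bijective (psi \o lam).
    apply: unipotent_bij => [d f f0|i].
      by do 2 apply: ps_subst_ord.
    rewrite /= composeX; under eq_bigr do rewrite psiX.
    by rewrite linear_mul // mulmxV.
  by move=> back _ backK; exists (lam (back g)); apply: backK.
have [back compK backK] : bijective (phi \o psi).
  apply: unipotent_bij => [d f f0|i].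
    by do 2 apply: ps_subst_ord.
  rewrite /= composeX -[X in ps_eqm 2 _ X](linear_mul _ _ i (mulVmx J_unit)).
  apply: ps_eqm_sum => j _; apply: ps_eqmZ; rewrite phiX.
  exact: jacobian_eqm.
apply: injective_surjective_bij => [f g|g]; last by exists (psi (back g)); apply: backK.
have [f' <-] := psi_surj f; have [g' <-] := psi_surj g.
by move=> E; congr (psi _); apply: (can_inj compK E).
Qed.

End InverseFunction.

(** * The orbit as the image of the parametrisation c *)

Lemma mcoeff_mpoly_jet (R : comNzRingType) s k (p : {mpoly R[s]}) a :
  (mpoly_jet k p)@_a = if (mdeg a < k.+1)%N then p@_a else 0.
Proof. exact: (mcoeff_ps_jet k (ps_of_mpoly p) a). Qed.

Section OrbitParametrisation.
Variables (K : fieldType) (L : closedFieldType) (iota : {rmorphism K -> L}).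
Variables (m n s k : nat) (A : 'M[{mpoly K[s]}]_(m, n)).

Local Notation t := (ncoord m n s k).
Local Notation params := ('I_(nparam m n s k) -> L).
Local Notation AL := (map_mx (map_mpoly iota) A).
Implicit Types (v : params).

Definition spec v (c : KUVG K m n s k) : L := (map_mpoly iota c).@[v].

Lemma spec_additive v : zmod_morphism (spec v).
Proof. by move=> c d; rewrite /spec rmorphB mevalB. Qed.

Lemma spec_multiplicative v : monoid_morphism (spec v).
Proof. by split=> [|c d]; rewrite /spec ?rmorph1 ?meval1 // rmorphM mevalM. Qed.

HB.instance Definition _ v := GRing.isZmodMorphism.Build _ _ (spec v) (spec_additive v).
HB.instance Definition _ v := GRing.isMonoidMorphism.Build _ _ (spec v) (spec_multiplicative v).

Lemma spec_pvar v x : spec v (pvar K x) = v (enum_rank x).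
Proof. by rewrite /spec /pvar /= map_mpolyX mevalXU. Qed.

Lemma specC v c : spec v c%:MP = iota c.
Proof. by rewrite /spec /= map_mpolyC mevalC. Qed.

Definition specU v := map_mx (map_mpoly (spec v)) (matU K m n s k).
Definition specV v := map_mx (map_mpoly (spec v)) (matV K m n s k).
Definition specG v (i : 'I_s) : {mpoly L[s]} := map_mpoly (spec v) (polyG K m n k i).

Lemma mcoeff_spec_generic v (e : bool) (x : 'X_{1..s < k.+1} -> pindex m n s k)
    (a : 'X_{1..s < k.+1}) :
  (map_mpoly (spec v) (e%:R + \sum_b pvar K (x b) *: 'X_[bmnm b]))@_(bmnm a)
  = e%:R * (bmnm a == 0%MM)%:R + v (enum_rank (x a)).
Proof.
rewrite mcoeff_map_mpoly mcoeffD raddf_sum (bigD1 a) //= mcoeffZ mcoeffX eqxx mulr1.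
rewrite big1 ?addr0 => [|b /negbTE neq_b]; last first.
  by rewrite mcoeffZ mcoeffX (inj_eq val_inj) neq_b mulr0.
rewrite rmorphD /= spec_pvar; congr (_ + _).
by rewrite -mpolyC_nat mcoeffC rmorphM !rmorph_nat.
Qed.

Lemma mcoeff_specU v i j (a : 'X_{1..s < k.+1}) :
  (specU v i j)@_(bmnm a)
  = (i == j)%:R * (bmnm a == 0%MM)%:R + v (enum_rank (inl (inl (i, j, a)) : pindex m n s k)).
Proof. by rewrite !mxE (mcoeff_spec_generic v _ (fun b => inl (inl (i, j, b)))). Qed.

Lemma mcoeff_specV v i j (a : 'X_{1..s < k.+1}) :
  (specV v i j)@_(bmnm a)
  = (i == j)%:R * (bmnm a == 0%MM)%:R + v (enum_rank (inl (inr (i, j, a)) : pindex m n s k)).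
Proof. by rewrite !mxE (mcoeff_spec_generic v _ (fun b => inl (inr (i, j, b)))). Qed.

Lemma mcoeff_specG v i a :
  (specG v i)@_a
  = \sum_j (U_(j)%MM == a)%:R * ((i == j)%:R + v (enum_rank (inr (inl (i, j)) : pindex m n s k)))
  + \sum_(b : {a : 'X_{1..s < k.+1} | (2 <= mdeg a)%N})
      (bmnm (val b) == a)%:R * v (enum_rank (inr (inr (i, b)) : pindex m n s k)).
Proof.
rewrite /specG /polyG mcoeff_map_mpoly mcoeffD raddfD !raddf_sum /=; congr (_ + _).
  apply: eq_bigr => j _; rewrite mcoeffZ mcoeffX rmorphM mulrC !rmorph_nat.
  by rewrite rmorphD rmorph_nat /= /varG spec_pvar.
by apply: eq_bigr => b _; rewrite mcoeffZ mcoeffX rmorphM mulrC rmorph_nat /= /varH spec_pvar.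
Qed.

Lemma mcoeff_specG0 v i : (specG v i)@_0%MM = 0.
Proof.
rewrite mcoeff_specG !big1 ?addr0 // => [b _|j _]; last by rewrite mnm1_eq0 mul0r.
case: eqP => [b0|_]; last by rewrite mul0r.
by have := svalP b; rewrite b0 mdeg0.
Qed.

Lemma mcoeff_specG1 v i j :
  (specG v i)@_U_(j)%MM
  = (i == j)%:R + v (enum_rank (inr (inl (i, j)) : pindex m n s k)).
Proof.
rewrite mcoeff_specG [X in _ + X]big1 ?addr0 => [|b _].
  rewrite (bigD1 j) //= eqxx mul1r big1 ?addr0 // => l /negbTE neq_lj.
  by rewrite eq_mnm1 neq_lj mul0r.
case: eqP => [bj|_]; last by rewrite mul0r.
by have := svalP b; rewrite bj mdeg1.
Qed.

Lemma mcoeff_specG2 v i (b : {a : 'X_{1..s < k.+1} | (2 <= mdeg a)%N}) :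
  (specG v i)@_(bmnm (val b)) = v (enum_rank (inr (inr (i, b)) : pindex m n s k)).
Proof.
rewrite mcoeff_specG big1 ?add0r => [|j _]; last first.
  case: eqP => [bj|_]; last by rewrite mul0r.
  by have := svalP b; rewrite -bj mdeg1.
rewrite (bigD1 b) //= eqxx mul1r big1 ?addr0 // => b' /negbTE neq_b.
by rewrite (inj_eq val_inj) (inj_eq val_inj) neq_b mul0r.
Qed.

Definition specB v : 'M[{mpoly L[s]}]_(m, n) :=
  map_mx (map_mpoly (spec v)) (matB k A).

Lemma ucoord_specB v l : ucoord (specB v) l = spec v (coefc A l).
Proof.
rewrite /coefc /ucoord; case: (enum_val l) => [[i j] a].
by rewrite mxE mcoeff_map_mpoly.
Qed.

Lemma spec_subst_G v p :
  ps_of_mpoly (map_mpoly (spec v) (subst_G m n k p))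
  = ps_eval (fun i => ps_of_mpoly (specG v i)) (map_mpoly iota p).
Proof.
apply: (mpoly_morph_eq
  (phi := @ps_of_mpoly s L \o map_mpoly (spec v)
          \o comp_mpoly [tuple polyG K m n k i | i < s] \o map_mpoly (@mpolyC _ K))
  (psi := ps_eval (fun i => ps_of_mpoly (specG v i)) \o map_mpoly iota)) => [c|i] /=.
  rewrite !map_mpolyC comp_mpolyC map_mpolyC ps_of_mpolyC /ps_eval mmapC.
  by rewrite /= specC.
rewrite !map_mpolyX comp_mpolyXU -tnth_nth tnth_mktuple.
by rewrite /ps_eval mmapX mmap1U.
Qed.

(** Taking jets before or after the multiplication gives the same result, which
    brings B into the form of the jet of g.A. *)
Lemma specB_jet v :
  specB v = map_mx (ps_jet k)
    (map_mx (@ps_of_mpoly s L) (specU v)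
     *m map_mx (ps_eval (fun i => ps_of_mpoly (specG v i))) AL
     *m map_mx (@ps_of_mpoly s L) (specV v)).
Proof.
have -> : map_mx (ps_eval (fun i => ps_of_mpoly (specG v i))) AL
        = map_mx (@ps_of_mpoly s L) (map_mx (map_mpoly (spec v)) (map_mx (@subst_G K m n s k) A)).
  by apply/matrixP => i j; rewrite !mxE; exact/esym/spec_subst_G.
rewrite /specB /matB /specU /specV -!map_mxM.
move: (_ *m _) => Y; apply/matrixP => i j; apply/mpolyP => a.
rewrite !mxE mcoeff_map_mpoly mcoeff_mpoly_jet mcoeff_ps_jet /= mcoeff_map_mpoly.
by case: ifP; rewrite ?rmorph0.
Qed.

Lemma is_jet_ps_jet (M : 'M[mpseries s L]_(m, n)) : is_jet k (map_mx (ps_jet k) M).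
Proof.
move=> i j; rewrite mxE msizeE; apply/bigmax_leqP_seq => a + _.
by rewrite mcoeff_msupp mcoeff_ps_jet; case: ifP => //; rewrite eqxx.
Qed.

(** An automorphism phi maps the maximal ideal, that is the nonunits, to itself;
    and phi(a) for a polynomial a is determined by the phi(x_i), as phi is a
    morphism of algebras. *)
Lemma orbit_specB B : jet_orbit k AL B -> exists v, B = specB v.
Proof.
case=> [[U V phi U_unit V_unit phi_bij]] /= ->.
pose h (i : 'I_s) := phi (psX L i).
have h0 i : ps_const (h i) = 0.
  apply/eqP/negPn/negP => c_neq0; set c := ps_const (h i) in c_neq0.
  have: phi (psX L i - c%:A) \is a GRing.unit.
    apply: (rmorph_unit phi); rewrite ps_unit_const rmorphB.
    by rewrite [X in X - _]ps_constX [X in _ - X]ps_constA sub0r oppr_eq0.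
  have -> : phi (psX L i - c%:A) = h i - c%:A by rewrite linearB linearZ /= rmorph1.
  by rewrite ps_unit_const rmorphB [X in _ - X]ps_constA subrr eqxx.
(* U, V and G have the Kronecker symbols built in, so they are subtracted here. *)
pose w (x : pindex m n s k) : L := match x with
  | inl (inl (i, j, a)) => pscoef (U i j) (bmnm a) - (i == j)%:R * (bmnm a == 0%MM)%:R
  | inl (inr (i, j, a)) => pscoef (V i j) (bmnm a) - (i == j)%:R * (bmnm a == 0%MM)%:R
  | inr (inl (i, j)) => pscoef (h i) U_(j)%MM - (i == j)%:R
  | inr (inr (i, b)) => pscoef (h i) (bmnm (val b))
  end.
pose v : params := fun i => w (enum_val i).
have vE x : v (enum_rank x) = w x by rewrite /v enum_rankK.
have UE i j : ps_eqm k.+1 (U i j) (ps_of_mpoly (specU v i j)).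
  move=> a lt_ak; rewrite [RHS](mcoeff_specU v i j (BMultinom lt_ak)) vE /=.
  by rewrite addrC subrK.
have VE i j : ps_eqm k.+1 (V i j) (ps_of_mpoly (specV v i j)).
  move=> a lt_ak; rewrite [RHS](mcoeff_specV v i j (BMultinom lt_ak)) vE /=.
  by rewrite addrC subrK.
have hE i : ps_eqm k.+1 (h i) (ps_of_mpoly (specG v i)).
  move=> a lt_ak /=; case: (ltngtP (mdeg a) 1%N) => [|gt_a1|/eqP/mdeg1P[j /eqP ->]].
  - by rewrite ltnS leqn0 mdeg_eq0 => /eqP ->; rewrite mcoeff_specG0 -(h0 i).
  - pose b : {a : 'X_{1..s < k.+1} | (2 <= mdeg a)%N} :=
      exist (fun a : 'X_{1..s < k.+1} => (2 <= mdeg a)%N) (BMultinom lt_ak) gt_a1.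
    by rewrite -[a]/(bmnm (val b)) mcoeff_specG2 vE.
  by rewrite mcoeff_specG1 vE /= addrC subrK.
exists v; rewrite specB_jet /glr_act /=; apply/matrixP => i j.
rewrite !mxE; apply/ps_jet_eqm.
apply: ps_eqm_sum => l _; rewrite !mxE.
apply: ps_eqmM; last by have := VE l j; rewrite !mxE; exact.
apply: ps_eqm_sum => l' _; rewrite !mxE.
apply: ps_eqmM; first by have := UE i l'; rewrite !mxE; exact.
set p := map_mpoly iota _.
have -> : phi (ps_of_mpoly p) = ps_eval h p.
  apply: (mpoly_morph_eq (phi := phi \o @ps_of_mpoly s L) (psi := ps_eval h)) => [c|x] /=.
    by rewrite ps_of_mpolyC linearZ rmorph1 /ps_eval mmapC.
  by rewrite /ps_eval mmapX mmap1U.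
rewrite /ps_eval /mmap; apply: ps_eqm_sum => a _.
apply: ps_eqmM; first exact: ps_eqm_refl.
rewrite /mmap1; apply: ps_eqm_prod => x _.
by apply: ps_eqmX; exact: hE.
Qed.

(** The equation of the complement of the group of k-jets in the affine space with
    coordinates U, V, G. *)
Definition unit_locus : KUVG K m n s k :=
  \det (\matrix_(i < m, j < m) ((i == j)%:R + varU K n i j (bm0 : 'X_{1..s < k.+1}))) *
  \det (\matrix_(i < n, j < n) ((i == j)%:R + varV K m i j (bm0 : 'X_{1..s < k.+1}))) *
  \det (\matrix_(i < s, j < s) ((i == j)%:R + varG K m n k i j)).

(** Where the determinants do not vanish, U and V are invertible matrices of
    polynomials, and G defines an automorphism. *)
Lemma specB_orbit v : spec v unit_locus != 0 -> jet_orbit k AL (specB v).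
Proof.
rewrite /unit_locus !rmorphM /= !mulf_eq0 !negb_or -!det_map_mx => /andP[/andP[dU dV] dG].
have U_unit : map_mx (@ps_of_mpoly s L) (specU v) \in unitmx.
  rewrite ps_unitmx; move: dU; congr (\det _ != 0); apply/matrixP => i j.
  rewrite !mxE rmorphD rmorph_nat /= /varU /varV spec_pvar.
  have := mcoeff_specU v i j bm0; rewrite eqxx mulr1 => <-.
  by rewrite /ps_const !mxE.
have V_unit : map_mx (@ps_of_mpoly s L) (specV v) \in unitmx.
  rewrite ps_unitmx; move: dV; congr (\det _ != 0); apply/matrixP => i j.
  rewrite !mxE rmorphD rmorph_nat /= /varU /varV spec_pvar.
  have := mcoeff_specV v i j bm0; rewrite eqxx mulr1 => <-.
  by rewrite /ps_const !mxE.
pose G i := ps_of_mpoly (specG v i).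
have G0 i : ps_eqm 1 (G i) 0 by apply/ps_const_ord; apply: mcoeff_specG0.
have G_unit : jacobian G \in unitmx.
  rewrite unitmxE unitfE; move: dG; congr (\det _ != 0); apply/matrixP => i j.
  by rewrite !mxE rmorphD rmorph_nat /= /varG spec_pvar /= mcoeff_specG1.
exists (Glr U_unit V_unit (glrPhi := ps_subst G0) (ps_subst_bij G0 G_unit)).
rewrite specB_jet /glr_act [glrU _]/= [glrV _]/= [glrPhi _]/=.
have -> // : map_mx (ps_subst G0) (map_mx (@ps_of_mpoly s L) AL) = map_mx (ps_eval G) AL.
by apply/matrixP => i j; rewrite !mxE; exact: ps_subst_mpoly.
Qed.

Lemma unit_locus_neq0 : map_mpoly iota unit_locus != 0.
Proof.
apply/eqP => /(congr1 (meval (fun=> 0))); rewrite meval0.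
rewrite -[LHS]/(spec (fun=> 0) unit_locus) /unit_locus !rmorphM /= -!det_map_mx.
have det1E N (M : 'M[KUVG K m n s k]_N) :
    (forall i j, spec (fun=> 0) (M i j) = (i == j)%:R) ->
    \det (map_mx (spec (fun=> 0)) M) = 1.
  by move=> ME; rewrite (_ : map_mx _ _ = 1%:M) ?det1 //; apply/matrixP => i j; rewrite !mxE ME.
rewrite !det1E ?mulr1 => [/eqP|i j|i j|i j]; first by rewrite oner_eq0.
all: by rewrite mxE rmorphD rmorph_nat /= /varU /varV /varG spec_pvar addr0.
Qed.

(** The orbit contains the values of c on a dense open set, so f(c) vanishes after
    multiplication by the equation of the complement. *)
Lemma vanishing_on_orbit (f : {mpoly L[t]}) :
  (forall B, jet_orbit k AL B -> f.@[ucoord B] = 0) ->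
  f \mPo [tuple map_mpoly iota (coefc A l) | l < t] = 0.
Proof.
move=> f0; set h := f \mPo _.
suff: h * map_mpoly iota unit_locus = 0.
  by move=> /eqP; rewrite mulf_eq0 (negbTE unit_locus_neq0) orbF => /eqP.
apply: mpoly_vanishing => v; rewrite mevalM.
have [->|v_unit] := eqVneq (map_mpoly iota unit_locus).@[v] 0; first by rewrite mulr0.
rewrite /h comp_mpoly_meval -[RHS](mul0r (map_mpoly iota unit_locus).@[v]).
congr (_ * _); rewrite -[RHS](f0 _ (specB_orbit v_unit)).
by apply: meval_eq => l; rewrite tnth_mktuple ucoord_specB.
Qed.

(** Any closed set containing the orbit is cut out by relations between the c_l over
    the extension field, hence contains the zero set of the relations over K. *)
Theorem variety_orbit_closure (F : seq {mpoly K[t]}) :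
  generates_elim_ideal A F -> forall B : 'M[{mpoly L[s]}]_(m, n),
  variety iota F B <-> zariski_closure k (jet_orbit k AL) B.
Proof.
move=> F_gen B; split=> [[B_jet FB] Z [E ZE] orbit_Z|].
  apply/ZE; split=> // f Ef.
  apply: (relations_base_change (iota := iota) (c := [tuple coefc A l | l < t])) => [g|].
    move=> /elim_ideal_kernel /F_gen [c ->].
    rewrite (raddf_sum (map_mpoly iota)) (raddf_sum (meval (ucoord B))) big1 // => i _.
    by rewrite /= rmorphM mevalM /= (FB _ (mem_nth 0 (ltn_ord i))) mulr0.
  have -> : [tuple map_mpoly iota (tnth [tuple coefc A l | l < t] l) | l < t]
          = [tuple map_mpoly iota (coefc A l) | l < t].
    by apply/eq_from_tnth => l; rewrite !tnth_mktuple.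
  by apply: vanishing_on_orbit => C /orbit_Z /ZE [_]; apply.
apply; last move=> C C_orbit.
  exists (fun f => exists2 g, g \in F & f = map_mpoly iota g) => C; split=> [[C_jet FC]|[C_jet FC]].
    by split=> // _ [g gF ->]; apply: FC.
  by split=> // g gF; apply: FC; exists g.
split=> [|f fF]; first by have [g ->] := C_orbit; apply: is_jet_ps_jet.
have [v ->] := orbit_specB C_orbit.
have /F_gen /elim_ideal_kernel : in_ideal F f by apply: in_ideal_mem.
move=> /(congr1 (spec v)); rewrite rmorph0 => <-.
rewrite -[RHS]/(((map_mpoly iota) (f \mPo _)).@[v]).
have -> : map_mpoly iota (f \mPo [tuple coefc A l | l < t])
        = map_mpoly iota f \mPo [tuple map_mpoly iota (coefc A l) | l < t].
  apply: (mpoly_morph_eq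
    (phi := map_mpoly iota \o comp_mpoly [tuple coefc A l | l < t])
    (psi := comp_mpoly [tuple map_mpoly iota (coefc A l) | l < t] \o map_mpoly iota)) => [c|l] /=.
    by rewrite comp_mpolyC !map_mpolyC comp_mpolyC.
  by rewrite map_mpolyX !comp_mpolyXU -!tnth_nth !tnth_mktuple.
rewrite comp_mpoly_meval; apply: meval_eq => l.
by rewrite tnth_mktuple ucoord_specB.
Qed.

End OrbitParametrisation.

Theorem mainTheorem4 (K : fieldType) (Kbar : closedFieldType)
    (iota : {rmorphism K -> Kbar}) (Kbar_alg : forall z, algebraicOver iota z)
    (m n s k : nat) (A : 'M[{mpoly K[s]}]_(m, n)) (A_jet : is_jet k A)
    (le : rel 'X_{1..nparam m n s k + ncoord m n s k}) (le_elim : elim_order le) :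
  let t := ncoord m n s k in
  let correct (F : seq {mpoly K[t]}) :=
    generates_elim_ideal A F /\
    (forall B : 'M[{mpoly Kbar[s]}]_(m, n),
       variety iota F B <->
       zariski_closure k (jet_orbit k (map_mx (map_mpoly iota) A)) B) in
  [/\ t = (m * n * 'C(s + k, k))%N,
      exists fuel F, orbitEq le fuel A = Some F,
      forall fuel F, orbitEq le fuel A = Some F -> correct F
    & forall S, standard_basis le (graph_gens k A) S -> correct (elim_part S)].
Proof.
move=> t correct.
have leP := elim_order_monomial le_elim.
have correctP S : standard_basis le (graph_gens k A) S -> correct (elim_part S).
  move=> /(elim_part_generates le_elim) S_gen; split=> //.
  exact: variety_orbit_closure.
split=> //; first exact: ncoordE.
  have [F [M bM]] := buchberger_terminates leP (graph_gens k A).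
  by exists M, (elim_part F); rewrite /orbitEq bM.
move=> fuel F; rewrite /orbitEq.
case E: buchberger => [S|] //= [<-]; apply: correctP.
exact: (buchberger_standard_basis leP E).
Qed.
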